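(* Let $L,T,\omega,b\in(0,\infty)$, let $\mathbf{e_g}\in\mathbb{R}^3$ with $|\mathbf{e_g}|=1$, let $\mathbf f:[0,L]\times[0,T]\to\mathbb{R}^3$ be continuous, and let $N\in\mathbb{N}$, $\tau=T/N$. On every time level $k=1,\dots,N-1$, the constrained minimization problem $$\text{minimize } J_{k+1}\text{ over the domain }\mathcal K_{k+1}=\{\mathbf v\in\mathcal V : e_{k+1}(\mathbf v)=0\}$$ has a unique solution $\mathbf r_{k+1}\in\mathcal K_{k+1}$.
   Context: $\Omega_L=(0,L)$, $t_k=k\tau$, $\mathbf f_k=\mathbf f(\cdot,t_k)$. Let $\mathcal V=\{\mathbf v\in\mathcal{H}^2(\Omega_L;\mathbb{R}^3):\mathbf v(L)=\mathbf 0,\ \partial_s\mathbf v(L)=-\mathbf{e_g}\}$, where $\mathcal{H}^2=\mathcal{W}^{2,2}$. Set $\mathbf r_0(s)=\mathbf r_1(s)=(L-s)\mathbf{e_g}$. The problems are defined recursively: for $k=1,\dots,N-1$, given $\mathbf r_{k-1},\mathbf r_k\in\mathcal V$ (the initial data or the minimizers of the previous levels), put $\mathrm D^2_{k+1}\mathbf v=(\mathbf v-2\mathbf r_k+\mathbf r_{k-1})/\tau^2$, $$J_{k+1}(\mathbf v)=\omega\|\tau\mathrm D_{k+1}^2\mathbf v\|^2_{\mathcal{L}^2(\Omega_L)}+b\|\partial_{ss}\mathbf v\|^2_{\mathcal{L}^2(\Omega_L)}-2(\mathbf f_{k+1},\mathbf v)_{\mathcal{L}^2(\Omega_L)},\quad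 e_{k+1}(\mathbf v)=2\,\partial_s(\mathbf v-\mathbf r_k)\cdot\partial_s\mathbf r_k,\qquad\mathbf v\in\mathcal V,$$ so that $e_{k+1}$ maps $\mathcal V$ into $\mathcal{H}^1_{0,L}(\Omega_L)=\{g\in\mathcal{H}^1(\Omega_L): g(L)=0\}$. *)

(* Defs.v *)
From HB Require Import structures.
From mathcomp Require Import all_boot all_order all_algebra.
From mathcomp Require Import all_classical all_reals all_analysis.

Set Implicit Arguments.
Unset Strict Implicit.
Unset Printing Implicit Defensive.

Import Order.TTheory GRing.Theory Num.Theory.
Import numFieldNormedType.Exports.

Local Open Scope classical_set_scope.
Local Open Scope ring_scope.

(* The norm `|x| that the library puts on 'rV[R]_n is the sup norm, hence a
   separate Euclidean one. *)
Definition dot (R : realType) (n : nat) (u v : 'rV[R]_n) : R :=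
  \sum_(i < n) u 0 i * v 0 i.

Definition enorm (R : realType) (n : nat) (u : 'rV[R]_n) : R :=
  Num.sqrt (dot u u).

(* Elements of Lebesgue and Sobolev spaces over (0, L) are represented by total
   functions on R; only their values in (0, L), up to null sets, matter. *)
Definition eq_L2 (R : realType) (L : R) (U : Type) (u v : R -> U) : Prop :=
  {ae (@lebesgue_measure R), forall s, s \in `]0, L[ -> u s = v s}.

Definition L2 (R : realType) (L : R) (n : nat) : set (R -> 'rV[R]_n) :=
  [set v : R -> 'rV[R]_n | forall i : 'I_n,
    (fun s => v s 0 i : R) \_ `]0, L[ \in Lfun (@lebesgue_measure R) 2%:E].

Definition L2_inner (R : realType) (L : R) (n : nat) (u v : R -> 'rV[R]_n) : R :=
  \int[@lebesgue_measure R]_(s in `]0, L[) dot (u s) (v s).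

Definition L2_norm (R : realType) (L : R) (n : nat) (v : R -> 'rV[R]_n) : R :=
  Num.sqrt (L2_inner L v v).

(* C_c^oo(0, L), extended by zero to R. *)
Definition test_fun (R : realType) (L : R) : set (R -> R) :=
  [set phi : R -> R | (forall (k : nat) (x : R), derivable (derive1n k phi) x 1) /\
    exists a b : R, [/\ 0 < a, b < L & forall x, x \notin `[a, b] -> phi x = 0]].

Definition is_weak_deriv (R : realType) (L : R) (n : nat)
    (v g : R -> 'rV[R]_n) : Prop :=
  forall (phi : R -> R) (i : 'I_n), test_fun L phi ->
    \int[@lebesgue_measure R]_(s in `]0, L[) (v s 0 i * derive1 phi s) =
    - \int[@lebesgue_measure R]_(s in `]0, L[) (g s 0 i * phi s).

Definition H1 (R : realType) (L : R) (n : nat) : set (R -> 'rV[R]_n) :=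
  [set v | L2 L v /\ exists2 g, L2 L g & is_weak_deriv L v g].

(* A square-integrable weak derivative, determined up to null sets when v is in
   H1 and equal to the junk value 0 if there is none. *)
Definition weak_deriv (R : realType) (L : R) (n : nat) (v : R -> 'rV[R]_n) :
    R -> 'rV[R]_n :=
  xget (fun=> 0) [set g | L2 L g /\ is_weak_deriv L v g].

Definition H2 (R : realType) (L : R) (n : nat) : set (R -> 'rV[R]_n) :=
  [set v | H1 L v /\ H1 L (weak_deriv L v)].

(* A representative of v continuous on [0, L]; its values there are determined
   by v. Boundary values of Sobolev functions are those of this representative. *)
Definition cont_repr (R : realType) (L : R) (n : nat) (v : R -> 'rV[R]_n) :
    R -> 'rV[R]_n :=
  xget (fun=> 0) [set w | {within `[0, L], continuous w} /\ eq_L2 L v w].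

Definition boundary_value (R : realType) (L : R) (n : nat)
    (v : R -> 'rV[R]_n) : 'rV[R]_n := cont_repr L v L.

Definition admissible (R : realType) (L : R) (e_g : 'rV[R]_3) :
    set (R -> 'rV[R]_3) :=
  [set v | [/\ H2 L v, boundary_value L v = 0 &
               boundary_value L (weak_deriv L v) = - e_g]].

Definition second_diff (R : realType) (tau : R) (rcur rprev v : R -> 'rV[R]_3) :
    R -> 'rV[R]_3 :=
  fun s => (tau ^+ 2)^-1 *: (v s - 2 *: rcur s + rprev s).

(* In the next definitions rprev, rcur are the iterates at levels k - 1, k, and g is
   the force f(., t_(k+1)). *)
Definition energy (R : realType) (L omega b tau : R)
    (g rcur rprev v : R -> 'rV[R]_3) : R :=
  omega * L2_norm L (fun s => tau *: second_diff tau rcur rprev v s) ^+ 2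
  + b * L2_norm L (weak_deriv L (weak_deriv L v)) ^+ 2
  - 2 * L2_inner L g v.

Definition constraint (R : realType) (L : R) (rcur v : R -> 'rV[R]_3) : R -> R :=
  fun s => 2 * dot (weak_deriv L (fun x => v x - rcur x) s) (weak_deriv L rcur s).

Definition feasible (R : realType) (L : R) (e_g : 'rV[R]_3)
    (rcur : R -> 'rV[R]_3) : set (R -> 'rV[R]_3) :=
  [set v | admissible L e_g v /\ eq_L2 L (constraint L rcur v) (fun=> 0)].

Definition is_minimizer (R : realType) (T : Type) (J : T -> R) (K : set T)
    (v : T) : Prop :=
  K v /\ forall w, K w -> J v <= J w.

(* v solves the problem for r_(k+1), posed in terms of r_(k-1) and r_k. *)
Definition solves_level (R : realType) (L omega b tau : R) (e_g : 'rV[R]_3)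
    (f : R * R -> 'rV[R]_3) (r : nat -> R -> 'rV[R]_3) (k : nat)
    (v : R -> 'rV[R]_3) : Prop :=
  is_minimizer
    (energy L omega b tau (fun s => f (s, k.+1%:R * tau)) (r k) (r k.-1))
    (feasible L e_g (r k)) v.

(* r_0, ..., r_k is a run of the scheme: initial data followed by minimizers. *)
Definition is_run (R : realType) (L omega b tau : R) (e_g : 'rV[R]_3)
    (f : R * R -> 'rV[R]_3) (r : nat -> R -> 'rV[R]_3) (k : nat) : Prop :=
  [/\ r 0%N = (fun s => (L - s) *: e_g),
      r 1%N = (fun s => (L - s) *: e_g) &
      forall j, (0 < j < k)%N ->
        solves_level L omega b tau e_g f r j (r j.+1)].

(* Main.v *)
Require Import Defs.
From HB Require Import structures.
From mathcomp Require Import all_boot all_order all_algebra.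
From mathcomp Require Import all_classical all_reals all_analysis.
From mathcomp Require Import measurable_realfun.
From mathcomp Require Import ring lra.

Set Implicit Arguments.
Unset Strict Implicit.
Unset Printing Implicit Defensive.

Import Order.TTheory GRing.Theory Num.Theory.
Import numFieldNormedType.Exports.

Local Open Scope classical_set_scope.
Local Open Scope ring_scope.

(* The admissible curves are parametrized by their second derivative g in L^2:
   integrating g twice from L gives slope g and curve g. In terms of g the
   constraint becomes affine, since it only involves the primitive of g - g0, with
   g0 the second derivative of the current iterate, and the energy becomes a
   quadratic functional whose second-order part is at least b |g|^2. The
   parallelogram identity makes every minimizing sequence Cauchy in L^2 and gives
   uniqueness; both constraint and energy pass to the limit, because the two
   integrations are bounded from L^2 to the bounded functions.

   That weak derivatives may be integrated back rests on the du Bois-Reymond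
   lemma, for which the test functions x |-> exp(-1/(n(x-a))) exp(-1/(n(b-x))),
   tending to the indicator of (a, b), suffice. *)

(** * Smooth cut-offs *)

(** Weak derivatives and boundary values are choices, meaningful only up to null sets, so v and g
    are related by [eq_L2] throughout; integration then turns almost-everywhere equality of second
    derivatives into equality of curves at every point. The boundary conditions at L disappear into
    the two constants of integration, so that the competitors form an affine subspace of L^2 and
    only completeness of L^2 is called for. This subspace is nonempty since the current iterate
    satisfies its own constraint. Its closedness is proved pointwise: at almost every fixed s the
    constraint is one scalar equation, and integration is continuous from L^2 to the value at s. The
    estimates are of Young type, with a free parameter eta, and their constants are generous, kept
    as perfect squares so that they can be iterated. *)

Lemma is_derive_derive1 (R : realType) (f : R -> R) (x d : R) :
  is_derive x 1 f d -> derive1 f x = d.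
Proof. by move=> df; rewrite derive1E; apply: derive_val. Qed.

(** The classical flat function exp(-1/x), extended by 0 and multiplied by 1/x^m. The index m is
    there because differentiation only raises it, so the family generates its own derivatives. *)
Definition flat_exp (R : realType) (m : nat) (x : R) : R :=
  if 0 < x then x^-1 ^+ m * expR (- x^-1) else 0.

(** With y = 1/x, the exponential series bounds y^(m+2) / (m+2)! by exp y. The exponent m+2 leaves a
    factor x^2, which makes the difference quotient at 0 tend to 0. *)
Lemma flat_exp_le (R : realType) (m : nat) (x : R) :
  0 < x -> flat_exp m x <= m.+2`!%:R * x ^+ 2.
Proof.
move=> x0; rewrite /flat_exp x0 expRN.
have y0 : 0 < x^-1 by rewrite invr_gt0.
have := expR_ge1Dxn m.+1 (ltW y0).
set y := x^-1 in y0 *; set F : R := _%:R => h.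
have F0 : 0 < F by rewrite /F ltr0n fact_gt0.
have E0 : 0 < expR y by exact: expR_gt0.
rewrite ler_pdivrMr//.
have : y ^+ m.+2 / F <= expR y by lra.
rewrite ler_pdivrMr// => h2.
have -> : y ^+ m = y ^+ m.+2 * x ^+ 2.
  by rewrite -addn2 exprD -mulrA -exprMn /y mulVf ?gt_eqF// expr1n mulr1.
rewrite [leRHS]mulrAC; apply: ler_wpM2r; last by rewrite mulrC.
exact: sqr_ge0.
Qed.

Lemma flat_exp_ge0 (R : realType) (m : nat) (x : R) : 0 <= flat_exp m x.
Proof.
rewrite /flat_exp; case: ifPn => // x0.
by rewrite mulr_ge0 ?expR_ge0// exprn_ge0// invr_ge0 ltW.
Qed.

Lemma flat_exp_le0 (R : realType) (m : nat) (x : R) :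
  x <= 0 -> flat_exp m x = 0.
Proof. by rewrite /flat_exp leNgt => /negbTE ->. Qed.

Lemma is_derive_flat_exp (R : realType) (m : nat) (x : R) :
  is_derive x 1 (flat_exp m)
    (- m%:R * flat_exp m.+1 x + flat_exp m.+2 x).
Proof.
have [x0|x0|->] := ltgtP x 0.
- rewrite !flat_exp_le0 ?ltW// mulr0 addr0.
  apply: (near_eq_is_derive (f := cst 0)).
  by near=> y; rewrite flat_exp_le0 ?ltW//; near: y; exact: lt_nbhsl.
- apply: (near_eq_is_derive
    (f := fun z : R => z^-1 ^+ m * expR (- z^-1))).
    near=> y; rewrite /flat_exp ifT//; near: y; exact: lt_nbhsr.
  have xn0 : x != 0 by rewrite gt_eqF.
  have dV : is_derive x 1 (fun z : R => z^-1) (- x ^- 2 *: 1).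
    exact: is_deriveV.
  have dN : is_derive x 1 (fun z : R => - z^-1) (x ^- 2).
    by apply: is_derive_eq; rewrite scaleNr opprK scaler1.
  have dE : is_derive x 1 (fun z : R => expR (- z^-1))
      (expR (- x^-1) * x ^- 2).
    exact: (@is_derive1_comp _ expR (fun z : R => - z^-1)).
  have -> : (fun z : R => z^-1 ^+ m * expR (- z^-1)) =
      (fun z : R => z^-1) ^+ m * (fun z : R => expR (- z^-1)).
    by apply/funext => z; rewrite !fctE.
  refine (is_derive_eq (is_deriveM (is_deriveX m dV) dE) _).
  rewrite exprfctE /flat_exp x0 !scaler1 /=.
  rewrite /GRing.scale/= -!exprVn.
  case: m => [|m]; first by ring.
  by rewrite /= !exprS -natr1; ring.
- rewrite !flat_exp_le0// mulr0 addr0.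
  have cv : h^-1 *: (flat_exp m (h + 0 : R) - flat_exp m 0) @[h --> 0^'] --> (0 : R).
    apply/cvgrPdist_le => /= e e0.
    set C : R := m.+2`!%:R.
    have C0 : 0 < C by rewrite /C ltr0n fact_gt0.
    near=> y; rewrite sub0r normrN addr0 [X in _ - X]flat_exp_le0// subr0.
    have y0 : y != 0 by near: y; exact: nbhs_dnbhs_neq.
    have ye : `|y| <= e / C.
      near: y; apply: nbhs_dnbhs.
      exact/(@nbhs0_le _ R^o)/divr_gt0.
    have [yneg|ypos] := leP y 0.
      by rewrite flat_exp_le0// scaler0 normr0 ltW.
    rewrite /GRing.scale/= normrM (ger0_norm (x := y^-1)) ?invr_ge0 ?(ltW ypos)//.
    rewrite ger0_norm ?flat_exp_ge0// ler_pdivrMl//.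
    rewrite (le_trans (flat_exp_le _ ypos))// expr2 mulrA mulrC -/C.
    rewrite ler_pM2l// mulrC -ler_pdivlMr//.
    by rewrite (le_trans _ ye)// ler_norm.
  have E : (fun h : R => h^-1 *: ((flat_exp m \o shift 0) (h *: (1 : R)) - flat_exp m 0))
     = (fun h : R => h^-1 *: (flat_exp m (h + 0) - flat_exp m 0)).
    by apply/funext => h /=; rewrite /GRing.scale/= mulr1.
  apply: DeriveDef; last by rewrite /derive E; apply/cvg_lim.
  by apply/cvg_ex; exists 0; rewrite E.
Unshelve. all: by end_near. Qed.

(* Closed under differentiation, so that all its members are smooth. *)
Inductive cutoff_expr (R : realType) : (R -> R) -> Prop :=
| CutoffFlat m : cutoff_expr (flat_exp m)
| CutoffCst c : cutoff_expr (cst c)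
| CutoffAdd f g : cutoff_expr f -> cutoff_expr g -> cutoff_expr (f \+ g)
| CutoffMul f g : cutoff_expr f -> cutoff_expr g -> cutoff_expr (f \* g)
| CutoffAffine f a c : cutoff_expr f -> cutoff_expr (fun x => f (a * x + c)).

Lemma cutoff_expr_derive (R : realType) (f : R -> R) : cutoff_expr f ->
  exists2 g : R -> R, cutoff_expr g & forall x : R, is_derive x 1 f (g x).
Proof.
elim => {f} [m|c|f1 g1 f1e [f1' f1'e df1] g1e [g1' g1'e dg1]
  |f1 g1 f1e [f1' f1'e df1] g1e [g1' g1'e dg1]|f1 a c f1e [f1' f1'e df1]].
- exists ((cst (- m%:R) \* flat_exp m.+1) \+ flat_exp m.+2).
    by do 2 constructor; constructor.
  by move=> x; exact: is_derive_flat_exp.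
- exists (cst 0); first by constructor.
  by move=> x; exact: is_derive_cst.
- exists (f1' \+ g1'); first by constructor.
  by move=> x; apply: is_deriveD.
- exists ((f1' \* g1) \+ (f1 \* g1')).
    by do 2 constructor.
  move=> x; have := is_deriveM (df1 x) (dg1 x).
  move=> /is_derive_eq; apply.
  by rewrite /GRing.scale/= addrC [g1 x * _]mulrC.
- exists (cst a \* (fun x => f1' (a * x + c))).
    by do 2 constructor.
  move=> x; have da : is_derive x 1 (fun y : R => a * y + c) a.
    by apply: is_derive_eq; rewrite /GRing.scale/= mulr1 addr0.
  have := @is_derive1_comp _ f1 (fun y : R => a * y + c) _ _ _ (df1 _) da.
  by move=> /is_derive_eq; apply; rewrite mulrC.
Qed.

Definition smooth (R : realType) (f : R -> R) : Prop :=
  forall (k : nat) (x : R), derivable (derive1n k f) x 1.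

Lemma smooth_cutoff_expr (R : realType) (f : R -> R) :
  cutoff_expr f -> smooth f.
Proof.
move=> fe k; suff : cutoff_expr (derive1n k f).
  by move=> /cutoff_expr_derive[g _ dg] x; have [] := dg x.
elim: k => [|k /cutoff_expr_derive[g ge dg]] //.
rewrite derive1nS [X in cutoff_expr X](_ : _ = g)//.
by apply/funext => x; exact: is_derive_derive1.
Qed.

Definition cutoff (R : realType) (a b : R) (n : nat) (x : R) : R :=
  flat_exp 0 (n.+1%:R * (x - a)) * flat_exp 0 (n.+1%:R * (b - x)).

Lemma flat_exp0_le1 (R : realType) (x : R) : flat_exp 0 x <= 1.
Proof.
rewrite /flat_exp; case: ifPn => // x0; rewrite expr0 mul1r.
by rewrite expR_le1 oppr_le0 invr_ge0 ltW.
Qed.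

Lemma smooth_cutoff (R : realType) (a b : R) (n : nat) : smooth (cutoff a b n).
Proof.
apply: smooth_cutoff_expr.
have e1 : cutoff_expr (fun x : R => flat_exp 0 (n.+1%:R * x + - (n.+1%:R * a))).
  by apply: CutoffAffine; constructor.
have e2 : cutoff_expr (fun x : R => flat_exp 0 (- n.+1%:R * x + (n.+1%:R * b))).
  by apply: CutoffAffine; constructor.
have := CutoffMul e1 e2; congr (cutoff_expr _); apply/funext => x /=.
by rewrite /cutoff mulrBr; congr (_ * flat_exp 0 _); ring.
Qed.

Lemma cutoff_out (R : realType) (a b : R) (n : nat) (x : R) :
  x \notin `]a, b[ -> cutoff a b n x = 0.
Proof.
rewrite in_itv/= negb_and -!leNgt => /orP[xa|bx]; rewrite /cutoff.
  by rewrite flat_exp_le0 ?mul0r// mulr_ge0_le0// subr_le0.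
by rewrite [X in _ * X]flat_exp_le0 ?mulr0// mulr_ge0_le0// subr_le0.
Qed.

Lemma cutoff_ge0 (R : realType) (a b : R) (n : nat) (x : R) : 0 <= cutoff a b n x.
Proof. by rewrite mulr_ge0 ?flat_exp_ge0. Qed.

Lemma cutoff_le1 (R : realType) (a b : R) (n : nat) (x : R) : cutoff a b n x <= 1.
Proof. by rewrite mulr_ile1 ?flat_exp_ge0 ?flat_exp0_le1. Qed.

Lemma cvg_flat_exp0 (R : realType) (y : R) : 0 < y ->
  flat_exp 0 (n.+1%:R * y) @[n --> \oo] --> (1 : R).
Proof.
move=> y0.
have -> : (fun n : nat => flat_exp 0 (n.+1%:R * y)) =
    (fun n : nat => expR (- (y^-1 * n.+1%:R^-1))).
  apply/funext => n; rewrite /flat_exp mulr_gt0// expr0 mul1r.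
  by rewrite invfM mulrC.
rewrite -[X in _ --> X]expR0; apply: continuous_cvg; first exact: continuous_expR.
rewrite -oppr0; apply: cvgN; rewrite -[X in _ --> X](mulr0 y^-1).
apply: cvgMr; exact: cvg_harmonic.
Qed.

Lemma cvg_cutoff (R : realType) (a b x : R) : x \in `]a, b[ ->
  cutoff a b n x @[n --> \oo] --> (1 : R).
Proof.
rewrite in_itv/= => /andP[ax xb]; rewrite -[X in _ --> X]mulr1.
by apply: cvgM; apply: cvg_flat_exp0; rewrite subr_gt0.
Qed.

Lemma test_fun_cutoff (R : realType) (L a b : R) (n : nat) :
  0 < a -> b < L -> test_fun L (cutoff a b n).
Proof.
move=> a0 bL; split; first exact: smooth_cutoff.
exists a, b; split => // x xab; apply: cutoff_out.
by apply: contra xab; exact: subset_itv_oo_cc.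
Qed.

(** * Test functions on (0, L) *)

Section TestFun.
Variables (R : realType) (L : R).
Notation mu := (@lebesgue_measure R).
Notation intg g := (mu.-integrable `]0, L[ (EFin \o g)).

Lemma smooth_derive1 (f : R -> R) : smooth f -> smooth (derive1 f).
Proof.
move=> sf k x; have := sf k.+1 x.
by rewrite /derive1n iterSr.
Qed.

Lemma smooth_continuous (f : R -> R) : smooth f -> continuous f.
Proof.
by move=> sf x; apply: differentiable_continuous; apply/derivable1_diffP/(sf 0%N).
Qed.

Lemma test_fun_derive1 (phi : R -> R) : test_fun L phi -> test_fun L (derive1 phi).
Proof.
move=> [sphi [a [b [a0 bL phi0]]]]; split; first exact: smooth_derive1.
exists a, b; split => // x xab.
apply: is_derive_derive1.
apply: (@near_eq_is_derive _ _ _ (cst 0)).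
have xN : nbhs x (~` [set` `[a, b]]).
  apply: open_nbhs_nbhs; split; last exact/negP.
  by apply: closed_openC; exact: interval_closed.
near=> y; rewrite /= phi0//; apply/negP; near: y; exact: xN.
Unshelve. all: by end_near. Qed.

Lemma test_fun_continuous (phi : R -> R) : test_fun L phi -> continuous phi.
Proof. by move=> [/smooth_continuous]. Qed.

Lemma test_fun_out (phi : R -> R) (x : R) : test_fun L phi ->
  x \notin `]0, L[ -> phi x = 0.
Proof.
move=> [_ [a [b [a0 bL phi0]]]] xL; apply: phi0; apply: contra xL.
rewrite !in_itv/= => /andP[ax xb].
by rewrite (lt_le_trans a0 ax) (le_lt_trans xb bL).
Qed.

Lemma test_fun_bounded (phi : R -> R) : test_fun L phi ->
  exists2 M, 0 <= M & forall x, `|phi x| <= M.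
Proof.
move=> tphi; have [sphi [a [b [a0 bL phi0]]]] := tphi.
have [ab|ba] := leP a b; last first.
  exists 0 => // x; rewrite phi0 ?normr0// in_itv/=.
  by apply/negP => /andP[h1 h2]; have := lt_le_trans ba (le_trans h1 h2); rewrite ltxx.
have cphi : {within `[a, b], continuous (fun x => `|phi x|)}.
  apply: continuous_subspaceT => x; apply: (@continuous_comp _ _ _ phi Num.norm).
    exact: test_fun_continuous.
  exact: norm_continuous.
have [c cab cmax] := EVT_max ab cphi.
exists `|phi c| => // x.
have [/cmax//|/phi0 ->] := boolP (x \in `[a, b]).
by rewrite normr0.
Qed.

Lemma measurable_test_fun (phi : R -> R) (D : set R) : test_fun L phi ->
  measurable_fun D phi.
Proof.
move=> tphi; apply: measurable_funTS.
apply: continuous_measurable_fun.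
exact: test_fun_continuous.
Qed.

Lemma integrable_mul_test_fun (g phi : R -> R) (D : set R) : measurable D ->
  test_fun L phi -> mu.-integrable D (EFin \o g) ->
  mu.-integrable D (EFin \o (fun x => g x * phi x)).
Proof.
move=> mD tphi ig; have [M M0 phiM] := test_fun_bounded tphi.
have : mu.-integrable D ((EFin \o phi) \* (EFin \o g))%E.
  apply: integrableMr => //; first exact: measurable_test_fun.
  exists M; split; first exact: num_real.
  by move=> y My x _ /=; rewrite (le_trans (phiM x))// ltW.
by apply: eq_integrable => // x _ /=; rewrite mulrC.
Qed.

Lemma integrable_cst_itv (c : R) : intg (cst c).
Proof.
apply: measurable_bounded_integrable => //=.
  rewrite lebesgue_measure_itv/=; case: ifP => // _.
  by rewrite -EFinD ltry.
by exists `|c|; split => // M cM x _ /=; exact: ltW.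
Qed.

Lemma integrable_test_fun (phi : R -> R) : test_fun L phi -> intg phi.
Proof.
move=> tphi; rewrite (_ : _ \o _ = EFin \o (fun x => cst 1 x * phi x)).
  by apply: integrable_mul_test_fun => //; exact: integrable_cst_itv.
by apply/funext => x /=; rewrite mul1r.
Qed.

Lemma integrable_test_funT (phi : R -> R) (D : set R) : measurable D ->
  test_fun L phi -> mu.-integrable D (EFin \o phi).
Proof.
move=> mD tphi; apply: (@integrableS _ _ _ _ setT) => //.
have <- : (EFin \o phi) \_ `]0, L[ = EFin \o phi.
  apply/funext => x; rewrite patchE; case: ifPn => // xI.
  rewrite /= (test_fun_out tphi)//; apply: contra xI; by rewrite inE.
apply: (iffLR (@integrable_mkcond _ _ _ mu `]0, L[ (EFin \o phi) _)) => //.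
exact: integrable_test_fun.
Qed.

Lemma Rintegral_derive1_test_fun (phi : R -> R) (s : R) : test_fun L phi ->
  \int[mu]_(t in `]-oo, s]) derive1 phi t = phi s.
Proof.
move=> tphi.
have tdphi := test_fun_derive1 tphi.
(* A point left of both s and 0: [phi] and its derivative vanish up to c, which reduces the
   half-line to a segment. *)
set c := Num.min s 0 - 1.
have cs : c < s by rewrite ltrBlDr gt_min ltrDl ltr01.
have c0 : c < 0 by rewrite ltrBlDr gt_min ltrDl ltr01 orbT.
have -> : \int[mu]_(t in `]-oo, s]) derive1 phi t =
    \int[mu]_(t in `[c, s]) derive1 phi t.
  rewrite Rintegral_mkcond [RHS]Rintegral_mkcond.
  apply: eq_Rintegral => x _; rewrite !patchE.
  have [xL|xL] := boolP (x \in `]0, L[); last first.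
    by rewrite (test_fun_out tdphi xL) !if_same.
  rewrite !mem_setE !in_itv/=.
  move: xL; rewrite in_itv/= => /andP[xL _].
  by rewrite (ltW (lt_trans c0 xL)).
rewrite /Rintegral (@continuous_FTC2 _ _ phi)//=.
- by rewrite (test_fun_out (x := c) tphi) ?subr0// in_itv/= (lt_gtF c0).
- by apply: continuous_subspaceT; exact: test_fun_continuous.
- split => [x _| |]; first exact: (tphi.1 0%N).
    exact/cvg_at_right_filter/test_fun_continuous.
  exact/cvg_at_left_filter/test_fun_continuous.
Qed.

End TestFun.

(** * Weak derivatives *)

Lemma ae_imply (R : realType) (P Q : R -> Prop) :
  (forall s, P s -> Q s) ->
  {ae (@lebesgue_measure R), forall s, P s} ->
  {ae (@lebesgue_measure R), forall s, Q s}.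
Proof.
move=> PQ; apply: filterS; first exact: (ae_filter_ringOfSetsType lebesgue_measure).
exact: PQ.
Qed.

Lemma ae_imply2 (R : realType) (P Q S : R -> Prop) :
  (forall s, P s -> Q s -> S s) ->
  {ae (@lebesgue_measure R), forall s, P s} ->
  {ae (@lebesgue_measure R), forall s, Q s} ->
  {ae (@lebesgue_measure R), forall s, S s}.
Proof.
move=> PQ; apply: filterS2; first exact: (ae_filter_ringOfSetsType lebesgue_measure).
exact: PQ.
Qed.

(** * The fundamental lemma and the du Bois-Reymond lemma *)

Section Fundamental.
Variables (R : realType) (L : R).
Notation mu := (@lebesgue_measure R).
Notation intg g := (mu.-integrable `]0, L[ (EFin \o g)).

Lemma Rintegral_subitv_eq0 (g : R -> R) (a b : R) : intg g ->
  (forall phi, test_fun L phi -> \int[mu]_(s in `]0, L[) (g s * phi s) = 0) ->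
  0 < a -> b < L -> \int[mu]_(s in `]a, b[) g s = 0.
Proof.
move=> ig g0 a0 bL.
have mg : measurable_fun `]0, L[ g by move: ig => /(measurable_int mu)/measurable_EFinP.
(* The cut-offs lie in [0, 1], so |g| is a majorant. *)
have [] := @dominated_convergence _ _ _ mu `]0, L[ _
  (fun n x => (g x * cutoff a b n x)%:E)
  (EFin \o (fun x => g x * \1_`]a, b[ x)) (EFin \o (fun x => `|g x|)).
- by [].
- move=> n; apply/measurable_EFinP; apply: measurable_funM => //.
  by apply: measurable_test_fun; exact: test_fun_cutoff a0 bL.
- by apply/measurable_EFinP; apply: measurable_funM => //; exact: measurable_indic.
- apply: aeW => x _ /=; apply: cvg_EFin; first exact: nearW.
  apply: cvgMr; have [xab|xab] := boolP (x \in `]a, b[).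
    by rewrite indicE mem_set//; exact: cvg_cutoff.
  rewrite indicE memNset//; last exact/negP.
  by rewrite (_ : cutoff a b ^~ x = cst 0)//; [exact: cvg_cst|
    apply/funext => n; rewrite cutoff_out].
- exact: integrable_norm.
- apply: aeW => x n _ /=; rewrite lee_fin normrM ler_piMr//.
  by rewrite ger0_norm ?cutoff_ge0 ?cutoff_le1.
move=> ig1 _.
have -> : (fun n => \int[mu]_(x in `]0%R, L[) (g x * cutoff a b n x)%:E)%E
    = cst 0%E.
  apply/funext => n /=; have tb := test_fun_cutoff n a0 bL.
  rewrite -[LHS]fineK.
    by have := g0 _ tb; rewrite /Rintegral => ->.
  apply: integrable_fin_num => //.
  exact: (integrable_mul_test_fun _ tb ig).
move=> /(cvg_unique _ (cvg_cst _)) h.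
have : \int[mu]_(x in `]0, L[) (g x * \1_`]a, b[ x) = 0.
  by rewrite /Rintegral -h.
rewrite -[RHS]/0 => <-.
rewrite Rintegral_mkcond [RHS]Rintegral_mkcond; apply: eq_Rintegral => x _.
rewrite !patchE indicE; case: (boolP (x \in [set` `]a, b[])) => xab.
  rewrite mulr1 ifT//; move: xab; rewrite !inE/= !in_itv/= => /andP[ax xb].
  by rewrite (lt_trans a0 ax) (lt_trans xb bL).
by rewrite mulr0 if_same.
Qed.

(** By Lebesgue differentiation, g is almost everywhere the derivative of the primitive F of its
    zero extension, and F is constant on (0, L) because g integrates to 0 over every inner
    interval. *)
Lemma fundamental_lemma (g : R -> R) : intg g ->
  (forall phi, test_fun L phi -> \int[mu]_(s in `]0, L[) (g s * phi s) = 0) ->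
  {ae mu, forall s, s \in `]0, L[ -> g s = 0}.
Proof.
move=> ig g0.
pose G := g \_ `]0, L[.
have iG (D : set R) : measurable D -> mu.-integrable D (EFin \o G).
  move=> mD; apply: (@integrableS _ _ _ _ setT) => //.
  rewrite -restrict_EFin.
  exact: (iffLR (@integrable_mkcond _ _ _ mu `]0, L[ (EFin \o g) _)).
have lG : locally_integrable [set: R] G by exact: integrable_locally.
have := FTC1Ny (fun y => iG _ (measurable_itv _)) lG.
apply: ae_imply => x /= [_ dGx] xI.
have -> : g x = G x by rewrite /G patchE mem_set.
rewrite -dGx; apply: is_derive_derive1.
set F := (f in is_derive _ _ f _).
apply: (@near_eq_is_derive _ _ _ (cst (F x))).
have : nbhs x [set` `]0, L[].
  by apply: open_nbhs_nbhs; split; first exact: interval_open.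
apply: filterS => y /= yI.
have main u v : u \in `]0, L[ -> v \in `]0, L[ -> u <= v -> F u = F v.
  rewrite !in_itv/= => /andP[u0 uL] /andP[v0 vL] uv.
  apply/eqP; rewrite eq_sym -subr_eq0 Rintegral_itvB ?bnd_simp//; last exact: iG.
  rewrite -Rintegral_itv_bndo_bndc; last exact: iG.
  rewrite -(Rintegral_subitv_eq0 ig g0 u0 vL); apply/eqP/eq_Rintegral => z.
  rewrite inE/= in_itv/= => /andP[uz zv]; rewrite /G patchE mem_set//=.
  by rewrite in_itv/= (lt_trans u0 uz) (lt_trans zv vL).
by have [/main->//|/ltW/main->] := leP x y.
Qed.

(** Integrating from -oo gives 0 left of the support; the zero mean gives 0 right of it as well. *)
Lemma test_fun_primitive (phi : R -> R) : test_fun L phi ->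
  \int[mu]_(s in `]0, L[) phi s = 0 ->
  exists2 Phi, test_fun L Phi & derive1 Phi = phi.
Proof.
move=> tphi phi0.
pose Phi x := \int[mu]_(t in `]-oo, x]) phi t.
have dPhi x : derivable Phi x 1 /\ derive1 Phi x = phi x.
  apply: (@continuous_FTC1 _ phi -oo%O x (x + 1)) => //.
  - by rewrite ltrDl.
  - exact: (integrable_test_funT _ tphi).
  - by rewrite ltNyr.
  - exact: (test_fun_continuous tphi).
have DE : derive1 Phi = phi by apply/funext => x; exact: (dPhi x).2.
exists Phi => //; split.
  case=> [x|k x]; first exact: (dPhi x).1.
  by rewrite /derive1n iterSr DE; exact: tphi.1.
have [_ [a [b [a0 bL phiout]]]] := tphi.
exists a, b; split => // x; rewrite in_itv/= negb_and -!ltNge => /orP[xa|bx].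
  rewrite /Phi (@eq_Rintegral _ _ _ mu _ (cst 0)) ?Rintegral_cst ?mul0r// => t.
  rewrite inE/= in_itv/= => tx; apply: phiout; rewrite in_itv/= negb_and -ltNge.
  by rewrite (le_lt_trans tx xa).
rewrite -phi0 /Phi Rintegral_mkcond [RHS]Rintegral_mkcond.
apply: eq_Rintegral => t _; rewrite !patchE.
have [/phiout ->|] := boolP (t \notin `[a, b]); first by rewrite !if_same.
rewrite negbK in_itv/= => /andP[at_ tb].
rewrite !mem_set//= in_itv/= ?(lt_le_trans a0 at_) ?(le_lt_trans tb bL)//.
exact: le_trans tb (ltW bx).
Qed.

(** Subtracting from psi the multiple of phi0 that cancels its mean leaves the derivative of a test
    function; testing u against it shows that u - c is orthogonal to every psi. *)
Lemma du_bois_reymond (u : R -> R) : 0 < L -> intg u ->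
  (forall phi, test_fun L phi ->
     \int[mu]_(s in `]0, L[) (u s * derive1 phi s) = 0) ->
  exists c, {ae mu, forall s, s \in `]0, L[ -> u s = c}.
Proof.
move=> L0 iu u0.
have [phi0 tphi0 m0] : exists2 phi0, test_fun L phi0 &
    \int[mu]_(s in `]0, L[) phi0 s != 0.
  (* If all test functions had mean 0, the constant 1 would integrate to 0 over (L/3, L/2). *)
  apply: contrapT => h.
  have h3 : \int[mu]_(s in `](L / 3), (L / 2)[) (cst 1 s : R) = 0.
    apply: Rintegral_subitv_eq0; [exact: integrable_cst_itv| |lra|lra].
    move=> phi tphi; under eq_Rintegral do rewrite /= mul1r.
    by apply: contrapT => /eqP phin0; apply: h; exists phi.
  move: h3; rewrite Rintegral_cst// mul1r /= lebesgue_measure_itv/= lte_fin.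
  rewrite ifT; last lra.
  rewrite /=; lra.
set m := (X in X != 0) in m0.
set c := (\int[mu]_(s in `]0, L[) (u s * phi0 s)) / m.
exists c.
suff : {ae mu, forall s, s \in `]0, L[ -> u s - c = 0}.
  by apply: ae_imply => s h /h /eqP; rewrite subr_eq0 => /eqP.
have ic : intg (cst c) by exact: integrable_cst_itv.
apply: (@fundamental_lemma (fun s => u s - c)).
  exact: (integrableB _ iu ic).
move=> psi tpsi.
set p := \int[mu]_(s in `]0, L[) psi s.
have ipsi := integrable_test_fun tpsi.
have iphi0 := integrable_test_fun tphi0.
have iuphi0 : intg (fun s => u s * phi0 s).
  exact: (integrable_mul_test_fun _ tphi0 iu).
have iupsi : intg (fun s => u s * psi s).
  exact: (integrable_mul_test_fun _ tpsi iu).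
have tchi : test_fun L (fun s => psi s - p / m * phi0 s).
  split.
    have := (tpsi.1, tphi0.1) => -[s1 s2] k.
    suff -> : derive1n k (fun s => psi s - p / m * phi0 s) =
       (fun s => derive1n k psi s - p / m * derive1n k phi0 s).
      by move=> x; apply: derivableB => //; apply: derivableZ.
    elim: k => // k IH; rewrite !derive1nS IH; apply/funext => x.
    have d1 := s1 k x; have d2 := s2 k x.
    apply: is_derive_derive1; apply: is_deriveB.
    - by rewrite derive1E; exact: derivableP.
    - by rewrite derive1E; apply: is_deriveZ; exact: derivableP.
  have [_ [a1 [b1 [a10 b1L o1]]]] := tpsi.
  have [_ [a2 [b2 [a20 b2L o2]]]] := tphi0.
  exists (Num.min a1 a2), (Num.max b1 b2); split.
  - by rewrite lt_min a10 a20.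
  - by rewrite gt_max b1L b2L.
  - move=> x xab; rewrite o1 ?o2 ?mulr0 ?subr0//; apply: contra xab;
    by rewrite !in_itv/= ge_min le_max => /andP[-> ->]; rewrite ?orbT.
have [Phi tPhi dPhi] : exists2 Phi, test_fun L Phi &
    derive1 Phi = (fun s => psi s - p / m * phi0 s).
  apply: test_fun_primitive => //.
  rewrite RintegralB//; last exact: (integrableZl _ _ iphi0).
  by rewrite RintegralZl// -/p -/m divfK// subrr.
have := u0 _ tPhi; rewrite dPhi.
under eq_Rintegral do rewrite mulrBr mulrCA.
rewrite RintegralB//; last exact: (integrableZl _ _ iuphi0).
rewrite RintegralZl// => h.
under eq_Rintegral do rewrite mulrBl.
rewrite RintegralB//; last exact: (integrableZl _ _ ipsi).
rewrite RintegralZl// -/p /c -[RHS]h; congr (_ - _).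
ring.
Qed.

End Fundamental.

(** * Primitives vanishing at L, and integration by parts *)

Section Primitive.
Variables (R : realType) (L : R).
Notation mu := (@lebesgue_measure R).
Notation intg g := (mu.-integrable `]0, L[ (EFin \o g)).

(* The cut-off (s <= t) makes prim defined and linear in h for every real s, inside
   (0, L) or not. *)
Definition prim (h : R -> R) (s : R) : R :=
  - \int[mu]_(t in `]0, L[) (h t * (s <= t)%R%:R).

Lemma integrable_tail (h : R -> R) (s : R) : intg h ->
  intg (fun t => h t * (s <= t)%R%:R).
Proof.
move=> ih; have mh := (measurable_EFinP _ _).1 (measurable_int mu ih).
apply: (le_integrable _ _ _ ih) => //.
  apply/measurable_EFinP; apply: measurable_funM => //.
  rewrite (_ : (fun t : R => (s <= t)%R%:R) = \1_`[s, +oo[); last first.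
    apply/funext => t; rewrite indicE mem_setE in_itv/= andbT//.
  exact: measurable_indic.
move=> t _ /=; rewrite lee_fin normrM; case: (s <= t).
  by rewrite normr1 mulr1.
by rewrite normr0 mulr0.
Qed.

Lemma primD (f g : R -> R) (s : R) : intg f -> intg g ->
  prim (fun t => f t + g t) s = prim f s + prim g s.
Proof.
move=> /(@integrable_tail _ s) If /(@integrable_tail _ s) Ig.
rewrite /prim -opprD -RintegralD//; congr (- _); apply: eq_Rintegral => t _.
by rewrite mulrDl.
Qed.

Lemma primZ (c : R) (f : R -> R) (s : R) : intg f ->
  prim (fun t => c * f t) s = c * prim f s.
Proof.
move=> /(@integrable_tail _ s) If.
rewrite /prim mulrN -RintegralZl//; congr (- _); apply: eq_Rintegral => t _.
by rewrite mulrA.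
Qed.

Lemma prim_L (f : R -> R) : prim f L = 0.
Proof.
rewrite /prim (@eq_Rintegral _ _ _ mu _ (cst 0)) ?Rintegral_cst ?mul0r ?oppr0// => t.
by rewrite inE/= in_itv/= => /andP[_ tL]; rewrite leNgt tL mulr0.
Qed.

Lemma normr_prim_le (f : R -> R) (s : R) : intg f ->
  `|prim f s| <= \int[mu]_(t in `]0, L[) `|f t|.
Proof.
move=> If; rewrite normrN; have It := integrable_tail s If.
apply: le_trans (le_normr_Rintegral _ It) _ => //.
apply: le_Rintegral => //.
- exact: integrable_norm.
- exact: integrable_norm.
- by move=> t _; rewrite normrM; case: (s <= t); rewrite ?normr0 ?mulr0// normr1 mulr1.
Qed.

Lemma prim_ae_eq (f g : R -> R) (s : R) : intg f -> intg g ->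
  {ae mu, forall t, t \in `]0, L[ -> f t = g t} -> prim f s = prim g s.
Proof.
move=> If Ig fg; congr (- fine _).
have [[mf _] [mg _]] := ((integrableP _ _ _ (integrable_tail s If)),
                        (integrableP _ _ _ (integrable_tail s Ig))).
apply: ae_eq_integral => //.
by apply: ae_imply fg => t h tI /=; rewrite h.
Qed.

Lemma prim_continuous (f : R -> R) : 0 < L -> intg f ->
  {within `[0, L], continuous (prim f)}.
Proof.
move=> L0 If.
pose G := f \_ `]0, L[.
have iG (D : set R) : measurable D -> mu.-integrable D (EFin \o G).
  move=> mD; apply: (@integrableS _ _ _ _ setT) => //.
  rewrite -restrict_EFin.
  exact: (iffLR (@integrable_mkcond _ _ _ mu `]0, L[ (EFin \o f) _)).
have cG := parameterized_integral_continuous (ltW L0) (iG _ (measurable_itv `[0, L])).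
(* On [0, L] the primitive from L is the primitive from 0 minus the total integral. *)
have E : {in `[0, L]%classic, (fun s => parameterized_integral mu 0 s G
    - \int[mu]_(t in `]0, L[) f t) =1 prim f}.
  move=> s; rewrite inE/= in_itv/= => /andP[s0 sL].
  have It := integrable_tail s If.
  rewrite /prim -[RHS]addr0 -[X in _ = _ + X](subrr (\int[mu]_(t in `]0, L[) f t)).
  rewrite addrA; congr (_ - _); rewrite addrC -RintegralB//.
  rewrite /parameterized_integral.
  rewrite -Rintegral_itv_bndo_bndc; last exact: iG.
  rewrite Rintegral_mkcond [RHS]Rintegral_mkcond; apply: eq_Rintegral => t _.
  rewrite /G !patchE !mem_setE !in_itv/=.
  case: (boolP (0 < t < L)) => [/andP[t0 tL]|]; last by rewrite if_same.
  by rewrite (ltW t0)/= leNgt; case: (t < s); rewrite ?mulr0 ?mulr1 ?subr0 ?subrr.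
apply: (@subspace_eq_continuous _ _ _ (fun s => parameterized_integral mu 0 s G
    - \int[mu]_(t in `]0, L[) f t)); first by move=> x xI; exact: E.
by apply: within_continuousB => //; apply: continuous_subspaceT => x; exact: cvg_cst.
Qed.

Lemma integrable_within_continuous (f : R -> R) :
  {within `[0, L], continuous f} -> intg f.
Proof.
move=> cf; have icc : mu.-integrable `[0, L] (EFin \o f).
  by apply: continuous_compact_integrable => //; exact: segment_compact.
by apply: integrableS icc => //; exact: subset_itv_oo_cc.
Qed.

(** Integration by parts for a merely integrable h: Fubini for h(t) phi'(s) on the region s <= t,
    where integrating in s gives phi(t). *)
Lemma Rintegral_prim_derive1 (h phi : R -> R) : 0 < L -> intg h ->
  test_fun L phi ->
  \int[mu]_(s in `]0, L[) (prim h s * derive1 phi s) =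
  - \int[mu]_(s in `]0, L[) (h s * phi s).
Proof.
move=> L0 ih tphi; have tdphi := test_fun_derive1 tphi.
pose G := h \_ `]0, L[.
have iG : mu.-integrable setT (EFin \o G).
  rewrite -restrict_EFin.
  exact: (iffLR (@integrable_mkcond _ _ _ mu `]0, L[ (EFin \o h) _)).
have mG : measurable_fun setT G.
  exact: ((measurable_EFinP _ _).1 (measurable_int mu iG)).
have mp : measurable_fun setT (derive1 phi) by exact: (measurable_test_fun tdphi).
pose F (x : R * R) : \bar R := (derive1 phi x.1 * (G x.2 * (x.1 <= x.2)%R%:R))%:E.
have mF : measurable_fun setT F.
  apply/measurable_EFinP; apply: measurable_funM.
    exact: measurableT_comp.
  apply: measurable_funM; first exact: measurableT_comp.
  rewrite (_ : (fun x : R * R => (x.1 <= x.2)%R%:R) = \1_[set x | x.1 <= x.2]); last first.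
    by apply/funext => x; rewrite indicE mem_setE.
  apply: measurable_indic.
  rewrite -[X in measurable X]setTI; apply: measurable_fun_ler => //.
(* |F| is at most |phi'(s)| |G(t)|, a product of integrable functions of one variable each. *)
have iF : (mu \x mu)%E.-integrable setT F.
  apply/integrable12ltyP => //.
  pose A : R := \int[mu]_y `|G y|.
  have iGn : mu.-integrable setT (fun y => `|G y|%:E) by exact: integrable_norm.
  have AE : A%:E = (\int[mu]_y `|G y|%:E)%E.
    by rewrite /A /Rintegral fineK//; exact: integrable_fin_num.
  apply: (@le_lt_trans _ _ (\int[mu]_x (A * `|derive1 phi x|)%:E)%E).
    apply: ge0_le_integral => //.
    - by move=> x _; exact: integral_ge0.
    - apply: (@measurable_fun_fubini_tonelli_F _ _ _ _ R mu (abse \o F)) => //.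
        exact: measurableT_comp.
      by move=> x; exact: abse_ge0.
    - apply/measurable_EFinP; apply: measurable_funM => //.
      exact: measurableT_comp.
    - move=> x _; rewrite mulrC EFinM AE -ge0_integralZl//; last first.
        by apply/measurable_EFinP; apply: measurableT_comp.
      apply: ge0_le_integral => //.
      + by apply: measurableT_comp => //; apply: measurableT_comp => //; exact: measurable_pair1.
      + by apply/measurable_EFinP; apply: measurable_funM => //; apply: measurableT_comp.
      + move=> y _; rewrite lee_fin !normrM ler_wpM2l//.
        by case: (x <= y); rewrite ?normr0 ?mulr0// normr1 mulr1.
  have iA : mu.-integrable setT (fun x => (A * `|derive1 phi x|)%:E).
    have iN : mu.-integrable setT (EFin \o (fun x => `|derive1 phi x|)).
      by apply: integrable_norm; exact: integrable_test_funT tdphi.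
    exact: (integrableZl _ A iN).
  have := integrable_fin_num measurableT iA.
  by rewrite fin_num_abs => h1; apply: le_lt_trans h1; exact: lee_abs.
have innerE x : (\int[mu]_y F (x, y))%E = (derive1 phi x * - prim h x)%:E.
  have iGx : mu.-integrable setT (EFin \o (fun y => G y * (x <= y)%R%:R)).
    have := iffLR (@integrable_mkcond _ _ _ mu `]0, L[ _ _) (integrable_tail x ih).
    move=> /(_ (measurable_itv _)); rewrite restrict_EFin.
    congr (_.-integrable _ (EFin \o _)); apply/funext => y.
    by rewrite /G !patchE; case: ifP => //; rewrite mul0r.
  rewrite /F/= -[LHS]fineK; last first.
    exact: (integrable_fin_num _ (integrableZl _ _ iGx)).
  congr EFin; rewrite -[LHS]/(\int[mu]_y (derive1 phi x * (G y * (x <= y)%R%:R))).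
  rewrite RintegralZl//; congr (_ * _); rewrite /prim opprK.
  rewrite [RHS]Rintegral_mkcond; apply: eq_Rintegral => y _.
  by rewrite /G !patchE; case: ifP => //; rewrite mul0r.
have outerE y : (\int[mu]_x F (x, y))%E = (G y * phi y)%:E.
  have ip : mu.-integrable setT (EFin \o (derive1 phi \_ `]-oo, y])).
    rewrite -restrict_EFin.
    apply: (iffLR (@integrable_mkcond _ _ _ mu `]-oo, y] (EFin \o derive1 phi) _)) => //.
    exact: integrable_test_funT tdphi.
  have FE : (fun x => F (x, y)) = (fun x => (G y * (derive1 phi \_ `]-oo, y]) x)%:E).
    apply/funext => x; rewrite /F/= patchE mem_setE in_itv/=.
    by case: (x <= y); rewrite ?mulr0// mulr1 mulrC.
  rewrite FE -[LHS]fineK; last first.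
    exact: (integrable_fin_num _ (integrableZl _ _ ip)).
  congr EFin; rewrite -[LHS]/(\int[mu]_x (G y * (derive1 phi \_ `]-oo, y]) x)).
  by rewrite RintegralZl// -Rintegral_mkcond (Rintegral_derive1_test_fun _ tphi).
have H : \int[mu]_x (derive1 phi x * - prim h x) = \int[mu]_y (G y * phi y).
  congr fine; transitivity (\int[mu]_x \int[mu]_y F (x, y))%E.
    by apply: eq_integral => x _; rewrite -innerE.
  by rewrite (Fubini iF); apply: eq_integral => y _; exact: outerE.
transitivity (- \int[mu]_x (derive1 phi x * - prim h x)).
  rewrite -[RHS]mulN1r -RintegralZl//; last first.
    have := integrable_fubini_F iF; congr (_.-integrable _ _).
    by apply/funext => x; exact: innerE.
  rewrite Rintegral_mkcond; apply: eq_Rintegral => x _; rewrite patchE.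
  case: ifPn => [_|xI]; first by ring.
  rewrite (test_fun_out tdphi) ?mul0r ?mulr0//.
  by apply: contra xI => xI; rewrite inE.
rewrite H; congr (- _); rewrite [RHS]Rintegral_mkcond; apply: eq_Rintegral => x _.
by rewrite /G !patchE; case: ifP => //; rewrite mul0r.
Qed.

(** u and [prim h] have the same weak derivative, so the du Bois-Reymond lemma applies to their
    difference. *)
Lemma weak_deriv_primE (u h : R -> R) : 0 < L -> intg u -> intg h ->
  (forall phi, test_fun L phi ->
    \int[mu]_(s in `]0, L[) (u s * derive1 phi s) =
    - \int[mu]_(s in `]0, L[) (h s * phi s)) ->
  exists c, {ae mu, forall s, s \in `]0, L[ -> u s = prim h s + c}.
Proof.
move=> L0 iu ih uh.
have ip : intg (prim h) by apply: integrable_within_continuous; exact: prim_continuous.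
have [|phi tphi|c uc] := @du_bois_reymond _ L (fun s => u s - prim h s) L0.
- exact: (integrableB _ iu ip).
- under eq_Rintegral do rewrite mulrBl.
  have tdphi := test_fun_derive1 tphi.
  rewrite RintegralB//; last 2 first.
    exact: (integrable_mul_test_fun _ tdphi iu).
    exact: (integrable_mul_test_fun _ tdphi ip).
  by rewrite uh// Rintegral_prim_derive1// subrr.
- exists c; apply: ae_imply uc => s h1 /h1 <-; by rewrite addrC subrK.
Qed.

End Primitive.

(** * Square-integrable functions *)

Section SquareIntegrable.
Variables (R : realType) (L : R).
Notation mu := (@lebesgue_measure R).
Notation I := [set` `]0, L[%R].
Notation intg g := (mu.-integrable I (EFin \o g)).

(** Square integrability phrased with integrals over the interval, whereas [L2] uses [Lfun] of the
    extension by zero; [sqint_Lfun] is the bridge. *)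
Definition sqint (f : R -> R) : Prop :=
  measurable_fun I f /\ intg (fun s => f s ^+ 2).

Lemma intg_measurable (f : R -> R) : intg f -> measurable_fun I f.
Proof. by move=> /(measurable_int mu)/measurable_EFinP. Qed.

Lemma intg_le (f g : R -> R) : measurable_fun I f -> intg g ->
  (forall s, `|f s| <= g s) -> intg f.
Proof.
move=> mf ig fg; apply: (le_integrable _ _ _ ig) => //; first exact/measurable_EFinP.
by move=> s _ /=; rewrite lee_fin (le_trans (fg s))// ler_norm.
Qed.

Lemma eq_intg (f g : R -> R) : f =1 g -> intg f -> intg g.
Proof. by move=> /funext ->. Qed.

Lemma intgD (f g : R -> R) : intg f -> intg g -> intg (fun s => f s + g s).
Proof. by move=> fi gi; exact: (integrableD _ fi gi). Qed.

Lemma intgZ (c : R) (f : R -> R) : intg f -> intg (fun s => c * f s).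
Proof. by move=> fi; exact: (integrableZl _ _ fi). Qed.

Lemma sqint_mul (f g : R -> R) : sqint f -> sqint g -> intg (fun s => f s * g s).
Proof.
move=> [mf f2] [mg g2]; apply: (intg_le _ (intgD f2 g2)).
  exact: measurable_funM.
move=> s; rewrite normrM.
rewrite -[X in _ <= X + _]real_normK ?num_real// -[X in _ <= _ + X]real_normK ?num_real//.
have := sqr_ge0 (`|f s| - `|g s|); have := mulr_ge0 (normr_ge0 (f s)) (normr_ge0 (g s)).
by nra.
Qed.

Lemma sqint_cst (c : R) : sqint (cst c).
Proof. by split=> //; exact: (integrable_cst_itv L (c ^+ 2)). Qed.

Lemma sqint_intg (f : R -> R) : sqint f -> intg f.
Proof.
by move=> sf; apply: eq_intg (sqint_mul sf (sqint_cst 1)) => s; rewrite /= mulr1.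
Qed.

Lemma sqintZ (c : R) (f : R -> R) : sqint f -> sqint (fun s => c * f s).
Proof.
move=> [mf f2]; split; first exact: measurable_funM.
by apply: eq_intg (intgZ (c ^+ 2) f2) => s; rewrite exprMn.
Qed.

Lemma sqintD (f g : R -> R) : sqint f -> sqint g -> sqint (fun s => f s + g s).
Proof.
move=> sf sg; have [mf f2] := sf; have [mg g2] := sg.
split; first exact: measurable_funD.
by apply: eq_intg (intgD (intgD f2 g2) (intgZ 2 (sqint_mul sf sg))) => s; ring.
Qed.

Lemma sqintB (f g : R -> R) : sqint f -> sqint g -> sqint (fun s => f s - g s).
Proof.
move=> sf sg; have := sqintD sf (sqintZ (-1) sg).
by congr sqint; apply/funext => s; rewrite mulN1r.
Qed.

Lemma sqint_continuous (f : R -> R) : {within `[0, L], continuous f} -> sqint f.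
Proof.
move=> cf; split; first by apply: intg_measurable; exact: integrable_within_continuous.
apply: (@integrable_within_continuous _ _ (fun s => f s ^+ 2)).
by move=> x; apply: continuousM; exact: cf.
Qed.

Lemma sqint_Lfun (f : R -> R) : sqint f <-> f \_ I \in Lfun mu 2%:E.
Proof.
split.
  move=> [mf f2].
  have mfI : measurable_fun setT (f \_ I).
    by apply/(measurable_restrictT _ _).1.
  rewrite inE; apply/andP; split; first by rewrite inE.
  rewrite inE/= /finite_norm unlock /Lnorm.
  apply: poweR_lty.
  have -> : (\int[mu]_x `|(EFin \o f \_ I) x| `^ 2)%E =
      (\int[mu]_(x in I) (f x ^+ 2)%:E)%E.
    rewrite [RHS]integral_mkcond; apply: eq_integral => x _ /=.
    rewrite powR_mulrn// real_normK ?num_real//.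
    by rewrite !patchE; case: ifP => // _; rewrite expr0n.
  have /(_ _)h := integrable_fin_num _ f2.
  by rewrite -ge0_fin_numE; [exact: h|apply: integral_ge0 => x _; rewrite lee_fin sqr_ge0].
move=> fL; have mfI : measurable_fun setT (f \_ I).
  by move: fL; rewrite inE => /andP[]; rewrite inE.
split; first by apply/(measurable_restrictT _ _).2.
have := Lfun2_integrable_sqr fL.
move=> h; apply/(@integrable_mkcond _ _ _ mu _ (EFin \o (fun s => f s ^+ 2))) => //.
move: h; congr (_.-integrable _ _); apply/funext => x /=.
by rewrite !patchE; case: ifP => //=; rewrite expr0n.
Qed.

Lemma Rintegral_cst_itv (c : R) : 0 < L -> \int[mu]_(s in I) (cst c s : R) = c * L.
Proof.
move=> L0; rewrite Rintegral_cst//= lebesgue_measure_itv/= lte_fin L0/=.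
by rewrite oppr0 addr0.
Qed.

(** Integrate |f| <= eta + f^2 / eta, which stands in for Cauchy-Schwarz. This is the origin of the
    factor L + 1 in the later bounds. *)
Lemma Rintegral_norm_le (f : R -> R) (eta : R) : 0 < L -> 0 < eta -> sqint f ->
  \int[mu]_(s in I) f s ^+ 2 <= eta ^+ 2 ->
  \int[mu]_(s in I) `|f s| <= (L + 1) * eta.
Proof.
move=> L0 eta0 sf; have [mf f2] := sf => fe.
have ic := integrable_cst_itv L eta.
have ig := intgZ eta^-1 f2.
apply: (@le_trans _ _ (\int[mu]_(s in I) (cst eta s + eta^-1 * f s ^+ 2))).
  apply: le_Rintegral => //.
  - by apply: integrable_norm; exact: sqint_intg.
  - exact: intgD.
  - move=> s _ /=; rewrite -[f s ^+ 2]real_normK ?num_real//.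
    rewrite -(ler_pM2l eta0) mulrDr mulrA mulfV ?gt_eqF// mul1r.
    have := sqr_ge0 (eta - `|f s|); have := mulr_ge0 (ltW eta0) (normr_ge0 (f s)).
    by nra.
rewrite RintegralD// Rintegral_cst_itv// RintegralZl// mulrDl mul1r mulrC.
by rewrite lerD2l ler_pdivrMl// -expr2.
Qed.

(** As in Riesz-Fischer: consecutive differences have L^1 norms at most (L + 1) 2^-n, so the sum of
    their absolute values is integrable, hence finite almost everywhere, and there the telescoping
    series converges absolutely. *)
Lemma sqint_cauchy_cvg (f_ : nat -> R -> R) : 0 < L -> (forall n, sqint (f_ n)) ->
  (forall n m, (n <= m)%N ->
    \int[mu]_(s in I) (f_ m s - f_ n s) ^+ 2 <= (2^-1 ^+ n) ^+ 2) ->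
  {ae mu, forall s, s \in `]0, L[ -> cvgn (fun n => f_ n s)}.
Proof.
move=> L0 sf fC.
pose d n s := `|f_ n.+1 s - f_ n s|.
have d0 n s : 0 <= d n s by exact: normr_ge0.
have id n : intg (d n) by apply: integrable_norm; apply: sqint_intg; exact: sqintB.
have md n : measurable_fun I (EFin \o d n) by exact: (measurable_int mu (id n)).
pose S s := (\sum_(n <oo) (d n s)%:E)%E.
have mS : measurable_fun I S.
  apply: (@ge0_emeasurable_sum _ _ _ _ (fun n s => (d n s)%:E) xpredT).
    by move=> k s _ _; rewrite lee_fin d0.
  by move=> k _; exact: md.
have iS : mu.-integrable I S.
  apply/integrableP; split => //.
  have -> : (\int[mu]_(s in I) `|S s| = \int[mu]_(s in I) S s)%E.
    apply: eq_integral.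
    by move=> s _; rewrite gee0_abs//; apply: nneseries_ge0 => n _ _; rewrite lee_fin d0.
  rewrite /S integral_nneseries//; last by move=> n s _; rewrite lee_fin d0.
  apply: (@le_lt_trans _ _ ((L + 1) * 2)%:E); last exact: ltry.
  apply: lime_le.
    by apply: is_cvg_nneseries => n _ _; apply: integral_ge0 => s _; rewrite lee_fin d0.
  apply: nearW => n /=.
  apply: (@le_trans _ _ (\sum_(0 <= i < n) ((L + 1) * 2^-1 ^+ i)%:E)%E).
    apply: lee_sum => i _.
    rewrite -[leLHS]fineK; last exact: (integrable_fin_num _ (id i)).
    rewrite lee_fin; apply: Rintegral_norm_le => //.
      exact: sqintB.
    exact: fC.
  rewrite sumEFin lee_fin -mulr_sumr ler_pM2l ?addr_gt0//.
  have -> : \sum_(0 <= i < n) 2^-1 ^+ i = 2 - 2 * 2^-1 ^+ n :> R.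
    elim: n => [|n IH]; first by rewrite big_nil expr0 mulr1 subrr.
    by rewrite big_nat_recr//= IH exprS; field.
  by rewrite gerBl mulr_ge0// exprn_ge0// invr_ge0.
have := integrable_ae _ iS; move=> /(_ (measurable_itv _)).
apply: ae_imply => s /= h sI; have {h}Sfin := h sI.
have cd : cvgn (series (fun n => d n s)).
  apply: nondecreasing_is_cvgn; first exact: nondecreasing_series.
  exists (fine (S s)) => _ [n _ <-].
  rewrite -lee_fin fineK// /S /series/= -sumEFin.
  by apply: nneseries_lim_ge => k _ _; rewrite lee_fin d0.
have ct : cvgn (series (telescope (fun n => f_ n s))) by exact: normed_cvg.
have -> : (fun n => f_ n s) =
    (fun n => f_ 0%N s + series (telescope (fun n => f_ n s)) n).
  by apply/funext => n; rewrite -eq_sum_telescope.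
by apply: is_cvgD => //; exact: is_cvg_cst.
Qed.

Lemma sqint_complete (f_ : nat -> R -> R) : 0 < L -> (forall n, sqint (f_ n)) ->
  (forall n m, (n <= m)%N ->
    \int[mu]_(s in I) (f_ m s - f_ n s) ^+ 2 <= (2^-1 ^+ n) ^+ 2) ->
  exists2 f, sqint f &
    forall n, \int[mu]_(s in I) (f s - f_ n s) ^+ 2 <= (2^-1 ^+ n) ^+ 2.
Proof.
move=> L0 sf fC.
(* An upper limit is measurable whether or not the sequence converges, and equals the limit where it
   does. *)
pose f s : R := fine (limn_esup (fun n => (f_ n s)%:E)).
have mf : measurable_fun I f.
  apply: measurableT_comp => //; apply: measurable_fun_limn_esup => n.
  by apply/measurable_EFinP; exact: (sf n).1.
have f_f : {ae mu, forall s, s \in `]0, L[ -> f_ n s @[n --> \oo] --> f s}.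
  apply: ae_imply (sqint_cauchy_cvg L0 sf fC) => s + sI => /(_ sI) cs.
  suff -> : f s = limn (fun n => f_ n s) by [].
  rewrite /f limn_esup_lim (@cvg_lim _ _ _ _ _ _ (limn (fun n => f_ n s))%:E)//.
  apply: cvg_esups; apply: cvg_EFin; first exact: nearW.
  exact: cs.
(* Fatou's lemma in m, with n fixed, passes the Cauchy bound to the limit. *)
have main n : (\int[mu]_(s in I) ((f s - f_ n s) ^+ 2)%:E <= ((2^-1 ^+ n) ^+ 2)%:E)%E.
  pose g m s : \bar R := ((f_ m s - f_ n s) ^+ 2)%:E.
  have mg m : measurable_fun I (g m).
    apply/measurable_EFinP; apply: measurable_funX; apply: measurable_funB.
      exact: (sf m).1.
    exact: (sf n).1.
  have mgn : measurable_fun I (fun s => limn_einf (g^~ s)).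
    apply: measurableT_comp => //.
    by apply: (@measurable_fun_limn_esup _ _ _ _ (fun m s => - g m s)%E) => m;
      apply: measurableT_comp.
  rewrite (@ae_eq_integral _ _ _ mu _ (fun s => limn_einf (g^~ s)))//; last 2 first.
    apply/measurable_EFinP; apply: measurable_funX; apply: measurable_funB => //.
    exact: (sf n).1.
    apply: ae_imply f_f => s + sI => /(_ sI) cs.
    rewrite limn_einf_lim (@cvg_lim _ _ _ _ _ _ ((f s - f_ n s) ^+ 2)%:E)//.
    apply: cvg_einfs; apply: cvg_EFin; first exact: nearW.
    by apply: cvgM; apply: cvgB => //; exact: cvg_cst.
  apply: (le_trans (fatou mu _ mg _)) => //.
    by move=> m s _; rewrite lee_fin sqr_ge0.
  rewrite limn_einf_lim; apply: lime_le; first exact: is_cvg_einfs.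
  apply: nearW => k; rewrite /einfs/=.
  (* The infimum runs over indices from k on, while the Cauchy bound is assumed for indices from n
     on; [maxn k n] meets both. *)
  apply: (@le_trans _ _ (\int[mu]_(s in I) g (maxn k n) s)%E).
    apply: ereal_inf_lbound; exists (maxn k n) => //=.
    by rewrite leq_maxl.
  rewrite -[leLHS]fineK.
    by rewrite lee_fin; apply: fC; rewrite leq_maxr.
  apply: (integrable_fin_num _ (sqintB (sf (maxn k n)) (sf n)).2) => //.
have sfn n : sqint (fun s => f s - f_ n s).
  split; first by apply: measurable_funB => //; exact: (sf n).1.
  apply/integrableP; split.
    by apply/measurable_EFinP; apply: measurable_funX; apply: measurable_funB => //; exact: (sf n).1.
  apply: le_lt_trans (ltry ((2^-1 ^+ n) ^+ 2)); apply: le_trans (main n).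
  by under eq_integral do rewrite /= ger0_norm ?sqr_ge0//.
exists f.
  by have := sqintD (sfn 0%N) (sf 0%N); congr sqint; apply/funext => s; rewrite subrK.
move=> n; rewrite -lee_fin; apply: le_trans (main n).
by rewrite /Rintegral fineK//; exact: (integrable_fin_num _ (sfn n).2).
Qed.

End SquareIntegrable.

(** * Vector-valued square-integrable functions *)

Section VectorL2.
Variables (R : realType) (L : R) (n : nat).
Notation mu := (@lebesgue_measure R).
Notation I := [set` `]0, L[%R].
Notation intg g := (mu.-integrable I (EFin \o g)).
Implicit Types u v w : R -> 'rV[R]_n.

Lemma L2P v : L2 L v <-> forall i, sqint L (fun s => v s 0 i).
Proof. by split=> h i; [apply/sqint_Lfun|apply/sqint_Lfun]; exact: h. Qed.

Lemma L2D u v : L2 L u -> L2 L v -> L2 L (fun s => u s + v s).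
Proof.
move=> /L2P lu /L2P lv; apply/L2P => i.
have -> : (fun s => (u s + v s) 0 i) = (fun s => u s 0 i + v s 0 i).
  by apply/funext => s; rewrite mxE.
exact: sqintD.
Qed.

Lemma L2Z c v : L2 L v -> L2 L (fun s => c *: v s).
Proof.
move=> /L2P lv; apply/L2P => i.
have -> : (fun s => (c *: v s) 0 i) = (fun s => c * v s 0 i).
  by apply/funext => s; rewrite mxE.
exact: sqintZ.
Qed.

Lemma L2B u v : L2 L u -> L2 L v -> L2 L (fun s => u s - v s).
Proof.
move=> lu lv; have := L2D lu (L2Z (-1) lv).
by congr (L2 _ _); apply/funext => s; rewrite scaleN1r.
Qed.

Lemma L2_continuous v :
  (forall i, {within `[0, L], continuous (fun s => v s 0 i)}) -> L2 L v.
Proof. by move=> cv; apply/L2P => i; apply: sqint_continuous; exact: cv. Qed.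

Lemma dotC (x y : 'rV[R]_n) : dot x y = dot y x.
Proof. by apply: eq_bigr => i _; rewrite mulrC. Qed.

Lemma dotDl (x y z : 'rV[R]_n) : dot (x + y) z = dot x z + dot y z.
Proof. by rewrite -big_split; apply: eq_bigr => i _; rewrite mxE mulrDl. Qed.

Lemma dotZl c (x y : 'rV[R]_n) : dot (c *: x) y = c * dot x y.
Proof. by rewrite /dot mulr_sumr; apply: eq_bigr => i _; rewrite mxE mulrA. Qed.

Lemma dot_ge0 (x : 'rV[R]_n) : 0 <= dot x x.
Proof. by apply: sumr_ge0 => i _; rewrite -expr2 sqr_ge0. Qed.

Lemma sqr_le_dot (x : 'rV[R]_n) i : x 0 i ^+ 2 <= dot x x.
Proof.
rewrite /dot (bigD1 i)//= -expr2 lerDl; apply: sumr_ge0 => j _.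
by rewrite -expr2 sqr_ge0.
Qed.

Lemma dot_eq0 (x : 'rV[R]_n) : dot x x = 0 -> x = 0.
Proof.
move=> x0; apply/rowP => i; rewrite mxE; apply/eqP; rewrite -sqrf_eq0 eq_le.
by rewrite sqr_ge0 andbT -x0 sqr_le_dot.
Qed.

Lemma intg_sum (f : 'I_n -> R -> R) : (forall i, intg (f i)) ->
  intg (fun s => \sum_i f i s) /\
  \int[mu]_(s in I) (\sum_i f i s) = \sum_i \int[mu]_(s in I) f i s.
Proof.
move=> fi; elim: (index_enum _) => [|i r [IH1 IH2]].
  split; last by rewrite big_nil; under eq_Rintegral do rewrite big_nil;
    rewrite Rintegral_cst// mul0r.
  by apply: eq_intg (integrable_cst_itv L 0) => s; rewrite big_nil.
split; first by apply: eq_intg (intgD (fi i) IH1) => s; rewrite big_cons.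
under eq_Rintegral do rewrite big_cons.
by rewrite big_cons -IH2 RintegralD//; exact: fi.
Qed.

Lemma intg_dot u v : L2 L u -> L2 L v -> intg (fun s => dot (u s) (v s)).
Proof.
move=> /L2P lu /L2P lv.
by apply: (intg_sum (f := fun i s => u s 0 i * v s 0 i) _).1 => i; exact: sqint_mul.
Qed.

Lemma L2_innerE u v : L2 L u -> L2 L v ->
  L2_inner L u v = \sum_i \int[mu]_(s in I) (u s 0 i * v s 0 i).
Proof.
move=> /L2P lu /L2P lv.
by apply: (intg_sum (f := fun i s => u s 0 i * v s 0 i) _).2 => i; exact: sqint_mul.
Qed.

Lemma L2_innerC u v : L2_inner L u v = L2_inner L v u.
Proof. by apply: eq_Rintegral => s _; exact: dotC. Qed.

Lemma L2_innerDl u v w : L2 L u -> L2 L v -> L2 L w ->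
  L2_inner L (fun s => u s + v s) w = L2_inner L u w + L2_inner L v w.
Proof.
move=> lu lv lw; rewrite /L2_inner; under eq_Rintegral do rewrite dotDl.
by rewrite RintegralD//; exact: intg_dot.
Qed.

Lemma L2_innerZl c u w : L2 L u -> L2 L w ->
  L2_inner L (fun s => c *: u s) w = c * L2_inner L u w.
Proof.
move=> lu lw; rewrite /L2_inner; under eq_Rintegral do rewrite dotZl.
by rewrite RintegralZl//; exact: intg_dot.
Qed.

Lemma L2_innerDr u v w : L2 L u -> L2 L v -> L2 L w ->
  L2_inner L w (fun s => u s + v s) = L2_inner L w u + L2_inner L w v.
Proof. by move=> lu lv lw; rewrite L2_innerC L2_innerDl// !(L2_innerC w). Qed.

Lemma L2_innerZr c u w : L2 L u -> L2 L w ->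
  L2_inner L w (fun s => c *: u s) = c * L2_inner L w u.
Proof. by move=> lu lw; rewrite L2_innerC L2_innerZl// (L2_innerC w). Qed.

Lemma L2_inner_ge0 u : 0 <= L2_inner L u u.
Proof. by apply: Rintegral_ge0 => s _; exact: dot_ge0. Qed.

Lemma L2_inner_ae u u' v v' : L2 L u -> L2 L v -> L2 L u' -> L2 L v' ->
  eq_L2 L u u' -> eq_L2 L v v' -> L2_inner L u v = L2_inner L u' v'.
Proof.
move=> lu lv lu' lv' uu vv; congr fine.
apply: ae_eq_integral => //.
- exact: (measurable_int mu (intg_dot lu lv)).
- exact: (measurable_int mu (intg_dot lu' lv')).
by apply: ae_imply2 uu vv => s h1 h2 sI; rewrite h1// h2.
Qed.

Lemma L2_inner_eq0 u : L2 L u -> L2_inner L u u <= 0 -> eq_L2 L u (fun=> 0).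
Proof.
move=> lu; rewrite le_eqVlt ltNge L2_inner_ge0 orbF => /eqP u0.
have iu := intg_dot lu lu.
have h : ae_eq mu I (EFin \o (fun s => dot (u s) (u s))) (cst 0%E).
  apply/ae_eq_integral_abs => //; first exact: (measurable_int mu iu).
  under eq_integral do rewrite gee0_abs ?lee_fin ?dot_ge0//.
  rewrite -[LHS]fineK; last exact: (integrable_fin_num _ iu).
  by rewrite -[X in X%:E]/(L2_inner L u u) u0.
by apply: ae_imply h => s hs sI; apply: dot_eq0; have [] := hs sI.
Qed.

Lemma coord_norm_le u (eta : R) i : 0 < L -> 0 < eta -> L2 L u ->
  L2_inner L u u <= eta ^+ 2 ->
  \int[mu]_(s in I) `|u s 0 i| <= (L + 1) * eta.
Proof.
move=> L0 eta0 lu ue; have sui := (L2P u).1 lu i.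
apply: Rintegral_norm_le => //; apply: le_trans ue.
apply: le_Rintegral => //; [exact: sui.2|exact: intg_dot|].
by move=> s _; exact: sqr_le_dot.
Qed.

(** Completeness is componentwise. The n components cost a factor n on the squares, enlarged to (n +
    1)^2 to keep a perfect square; in dimension three this is the factor 4 met below. *)
Lemma L2_complete (g_ : nat -> R -> 'rV[R]_n) : 0 < L -> (forall k, L2 L (g_ k)) ->
  (forall k m, (k <= m)%N ->
    L2_inner L (fun s => g_ m s - g_ k s) (fun s => g_ m s - g_ k s) <= (2^-1 ^+ k) ^+ 2) ->
  exists2 g, L2 L g & forall k,
    L2_inner L (fun s => g s - g_ k s) (fun s => g s - g_ k s) <= (n.+1%:R * 2^-1 ^+ k) ^+ 2.
Proof.
move=> L0 lg gC.
have comp (i : 'I_n) : exists f, sqint L f /\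
    forall k, \int[mu]_(s in I) (f s - g_ k s 0 i) ^+ 2 <= (2^-1 ^+ k) ^+ 2.
  have [|k m km|f sf fk] := @sqint_complete _ L (fun k s => g_ k s 0 i) L0.
  - by move=> k; exact: ((L2P _).1 (lg k)).
  - apply: le_trans (gC _ _ km); apply: le_Rintegral => //.
    + by apply: (sqintB _ _).2; exact: ((L2P _).1 (lg _)).
    + by apply: intg_dot; exact: L2B.
    + by move=> s _; apply: le_trans (sqr_le_dot _ i); rewrite !mxE.
  - by exists f.
have [f fP] := choice comp.
pose g s : 'rV[R]_n := \row_i f i s.
have lL : L2 L g.
  apply/L2P => i; have := (fP i).1; congr sqint; apply/funext => s.
  by rewrite mxE.
exists g => // k.
rewrite L2_innerE; [|exact: L2B|exact: L2B].
apply: (@le_trans _ _ (\sum_(i < n) (2^-1 ^+ k) ^+ 2)).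
  apply: ler_sum => i _; apply: le_trans ((fP i).2 k).
  by rewrite le_eqVlt; apply/orP; left; apply/eqP/eq_Rintegral => s _; rewrite !mxE expr2.
rewrite sumr_const card_ord -[leLHS]mulr_natl exprMn ler_wpM2r ?sqr_ge0//.
by rewrite -natrX ler_nat expnS expn1 (leq_trans (leqnSn n))// leq_pmulr.
Qed.

End VectorL2.

(** * Vector-valued Sobolev functions *)

Section Boundary.
Variables (R : realType) (L : R).
Hypothesis L0 : 0 < L.
Notation mu := (@lebesgue_measure R).

(** If d L were nonzero, d would be nonzero on some (a, L), an interval of positive measure inside a
    null set. *)
Lemma continuous_ae0_right (d : R -> R) : {within `[0, L], continuous d} ->
  {ae mu, forall s, s \in `]0, L[ -> d s = 0} -> d L = 0.
Proof.
move=> /(continuous_within_itvP _ L0)[_ _ dL] d0.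
apply: contrapT => /eqP dL0.
have : \forall x \near L^'-, d x != 0.
  have h : nbhs (d L) [set y | y != 0].
    by apply: open_nbhs_nbhs; split => //; exact: open_neq.
  exact: dL h.
move=> [/= e e0 he].
pose a := Num.max 0 (L - e).
have aL : a < L by rewrite gt_max L0 ltrBlDr ltrDl.
have [A [mA A0 sA]] := d0.
have sub : [set` `]a, L[] `<=` A.
  move=> x /=; rewrite in_itv/= gt_max => /andP[/andP[x0 xe] xL].
  apply: sA => /=; rewrite in_itv/= x0 xL => /(_ isT) dx0.
  have : d x != 0.
    apply: he => //=; rewrite gtr0_norm ?subr_gt0//.
    by rewrite ltrBlDr addrC -ltrBlDr.
  by rewrite dx0 eqxx.
have : (mu [set` `]a, L[] <= mu A)%E by apply: le_measure => //; rewrite inE.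
by rewrite A0 lebesgue_measure_itv/= lte_fin aL lee_fin leNgt subr_gt0 aL.
Qed.

Variable n : nat.
Implicit Types u v w : R -> 'rV[R]_n.

Lemma within_continuous_coord w i : {within `[0, L], continuous w} ->
  {within `[0, L], continuous (fun s => w s 0 i)}.
Proof.
move=> cw; apply: (@within_continuous_comp _ _ _ `[0, L]%classic w
  (fun M : 'rV[R]_n => M 0 i)) => // M _; exact: coord_continuous.
Qed.

Lemma within_continuous_row w :
  (forall i, {within `[0, L], continuous (fun s => w s 0 i)}) ->
  {within `[0, L], continuous w}.
Proof.
move=> cw x; apply/cvg_ballP => e e0.
have h (i : 'I_n) : \forall y \near (x : subspace `[0, L]), ball (w x 0 i) e (w y 0 i).
  by have /cvg_ballP := cw i x; apply.
have /(@filter_forall) H := h.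
near=> y; split => // i j; rewrite ord1; move: j.
by near: y; exact: H.
Unshelve. all: by end_near. Qed.

(** Two continuous representatives differ by a continuous function that vanishes almost everywhere,
    so the choice in [cont_repr] does not affect the value at L. *)
Lemma boundary_valueE v w : {within `[0, L], continuous w} -> eq_L2 L v w ->
  boundary_value L v = w L.
Proof.
move=> cw vw.
have : exists w', {within `[0, L], continuous w'} /\ eq_L2 L v w' by exists w.
move=> /(@xgetPex _ (fun=> 0 : 'rV[R]_n)); rewrite -/(cont_repr L v).
move=> [cw' vw']; rewrite /boundary_value; apply/rowP => i.
apply/eqP; rewrite -subr_eq0; apply/eqP.
apply: (@continuous_ae0_right (fun s => cont_repr L v s 0 i - w s 0 i)).
  apply: (@within_continuousB _ _ _ _ (fun s => cont_repr L v s 0 i)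
    (fun s => w s 0 i)); exact: within_continuous_coord.
by apply: ae_imply2 vw vw' => s h1 h2 sI; rewrite -h1// -h2// subrr.
Qed.

End Boundary.

Section WeakDerivative.
Variables (R : realType) (L : R).
Hypothesis L0 : 0 < L.
Notation mu := (@lebesgue_measure R).
Notation I := [set` `]0, L[%R].
Notation intg g := (mu.-integrable I (EFin \o g)).
Variable n : nat.
Implicit Types u v w h : R -> 'rV[R]_n.

Lemma L2_intg v i : L2 L v -> intg (fun s => v s 0 i).
Proof. by move=> /L2P /(_ i); exact: sqint_intg. Qed.

Lemma Rintegral_ae_mul_test_fun (f g phi : R -> R) : intg f -> intg g ->
  test_fun L phi -> {ae mu, forall s, s \in `]0, L[ -> f s = g s} ->
  \int[mu]_(s in I) (f s * phi s) = \int[mu]_(s in I) (g s * phi s).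
Proof.
move=> fi gi tphi fg; congr fine; apply: ae_eq_integral => //.
- exact: (measurable_int mu (integrable_mul_test_fun _ tphi fi)).
- exact: (measurable_int mu (integrable_mul_test_fun _ tphi gi)).
by apply: ae_imply fg => s h sI; rewrite h.
Qed.

Lemma is_weak_deriv_ae v v' h h' : L2 L v -> L2 L v' -> L2 L h -> L2 L h' ->
  eq_L2 L v v' -> eq_L2 L h h' -> is_weak_deriv L v h -> is_weak_deriv L v' h'.
Proof.
move=> lv lv' lh lh' vv hh wd phi i tphi.
rewrite -(@Rintegral_ae_mul_test_fun (fun s => v s 0 i)).
- rewrite wd//; congr (- _); apply: Rintegral_ae_mul_test_fun => //.
  + exact: L2_intg.
  + exact: L2_intg.
  + by apply: ae_imply hh => s e sI; rewrite e.
- exact: L2_intg.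
- exact: L2_intg.
- exact: test_fun_derive1.
- by apply: ae_imply vv => s e sI; rewrite e.
Qed.

Lemma is_weak_deriv_unique v h h' : L2 L h -> L2 L h' ->
  is_weak_deriv L v h -> is_weak_deriv L v h' -> eq_L2 L h h'.
Proof.
move=> lh lh' wh wh'.
have H (i : 'I_n) : {ae mu, forall s, s \in `]0, L[ -> h s 0 i - h' s 0 i = 0}.
  have ih := L2_intg i lh; have ih' := L2_intg i lh'.
  apply: fundamental_lemma; first exact: (integrableB _ ih ih').
  move=> phi tphi; under eq_Rintegral do rewrite mulrBl.
  rewrite RintegralB//.
  - apply/eqP; rewrite subr_eq0; apply/eqP/oppr_inj.
    by rewrite -wh// -wh'.
  - exact: integrable_mul_test_fun tphi ih.
  - exact: integrable_mul_test_fun tphi ih'.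
have : {ae mu, forall s, forall i, s \in `]0, L[ -> h s 0 i - h' s 0 i = 0}.
  exact: filter_forall.
by apply: ae_imply => s e sI; apply/rowP => i; apply/eqP; rewrite -subr_eq0 e.
Qed.

Lemma is_weak_derivB u v g h : L2 L u -> L2 L v -> L2 L g -> L2 L h ->
  is_weak_deriv L u g -> is_weak_deriv L v h ->
  is_weak_deriv L (fun s => u s - v s) (fun s => g s - h s).
Proof.
move=> lu lv lg lh ug vh phi i tphi.
have tdphi := test_fun_derive1 tphi.
have E (a b : R -> 'rV[R]_n) (psi : R -> R) : L2 L a -> L2 L b -> test_fun L psi ->
    \int[mu]_(s in I) ((a s - b s) 0 i * psi s) =
    \int[mu]_(s in I) (a s 0 i * psi s) - \int[mu]_(s in I) (b s 0 i * psi s).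
  move=> la lb tpsi; under eq_Rintegral do rewrite !mxE mulrBl.
  rewrite RintegralB//; first exact: (integrable_mul_test_fun _ tpsi (L2_intg i la)).
  exact: (integrable_mul_test_fun _ tpsi (L2_intg i lb)).
by rewrite !E// ug// vh// opprB opprK addrC.
Qed.

(** Makes the choice in [weak_deriv] harmless: by uniqueness it agrees with any square-integrable
    weak derivative at hand. *)
Lemma weak_derivP v h : L2 L h -> is_weak_deriv L v h ->
  [/\ L2 L (weak_deriv L v), is_weak_deriv L v (weak_deriv L v) &
      eq_L2 L (weak_deriv L v) h].
Proof.
move=> lh vh.
have [l w] : [set g | L2 L g /\ is_weak_deriv L v g] (weak_deriv L v).
  by apply: xgetPex; exists h.
by split => //; exact: (is_weak_deriv_unique (v := v)).
Qed.

Lemma H1P v : H1 L v -> [/\ L2 L v, L2 L (weak_deriv L v) &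
  is_weak_deriv L v (weak_deriv L v)].
Proof. by move=> [lv [h lh /(weak_derivP lh)[? ? _]]]. Qed.

Definition vprim h (s : R) : 'rV[R]_n := \row_i prim L (fun t => h t 0 i) s.

Lemma vprim_L h : vprim h L = 0.
Proof. by apply/rowP => i; rewrite !mxE prim_L. Qed.

Lemma vprim_continuous h : L2 L h -> {within `[0, L], continuous (vprim h)}.
Proof.
move=> lh; apply: within_continuous_row => i.
have -> : (fun s => vprim h s 0 i) = prim L (fun t => h t 0 i).
  by apply/funext => s; rewrite mxE.
by apply: prim_continuous => //; exact: L2_intg.
Qed.

(** The integral ignores null sets, hence equality at every point. *)
Lemma vprim_ae h h' : L2 L h -> L2 L h' -> eq_L2 L h h' -> vprim h = vprim h'.
Proof.
move=> lh lh' hh; apply/funext => s; apply/rowP => i; rewrite !mxE.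
apply: prim_ae_eq; [exact: L2_intg|exact: L2_intg|].
by apply: ae_imply hh => t e tI; rewrite e.
Qed.

Lemma vprimD h h' s : L2 L h -> L2 L h' ->
  vprim (fun t => h t + h' t) s = vprim h s + vprim h' s.
Proof.
move=> lh lh'; apply/rowP => i; rewrite !mxE -primD; try exact: L2_intg.
by congr prim; apply/funext => t; rewrite mxE.
Qed.

Lemma vprimZ c h s : L2 L h -> vprim (fun t => c *: h t) s = c *: vprim h s.
Proof.
move=> lh; apply/rowP => i; rewrite !mxE -primZ; try exact: L2_intg.
by congr prim; apply/funext => t; rewrite mxE.
Qed.

Lemma within_continuous_vprimD h c : L2 L h ->
  {within `[0, L], continuous (fun s => vprim h s + c)}.
Proof.
move=> lh; apply: (@within_continuousD _ _ _ _ (vprim h) (cst c)).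
  exact: vprim_continuous.
by apply: continuous_subspaceT => x; exact: cvg_cst.
Qed.

Lemma L2_vprimD h c : L2 L h -> L2 L (fun s => vprim h s + c).
Proof.
move=> lh; apply: L2_continuous => i; apply: within_continuous_coord.
exact: within_continuous_vprimD.
Qed.

Lemma L2_vprim h : L2 L h -> L2 L (vprim h).
Proof.
by move=> lh; have := L2_vprimD 0 lh; congr (L2 _ _); apply/funext => s; rewrite addr0.
Qed.

Lemma is_weak_deriv_vprimD h c : L2 L h ->
  is_weak_deriv L (fun s => vprim h s + c) h.
Proof.
move=> lh phi i tphi; have ih := L2_intg i lh.
have tdphi := test_fun_derive1 tphi.
have ip : intg (prim L (fun t => h t 0 i)).
  by apply: integrable_within_continuous; exact: prim_continuous.
under eq_Rintegral do rewrite !mxE mulrDl.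
rewrite RintegralD//; last 2 first.
- exact: integrable_mul_test_fun tdphi ip.
- by apply: intgZ; exact: integrable_test_fun.
rewrite Rintegral_prim_derive1// RintegralZl//; last exact: integrable_test_fun.
(* The constant c contributes a multiple of the integral of phi', which is phi(L) = 0. *)
suff -> : \int[mu]_(x in I) derive1 phi x = 0 by rewrite mulr0 addr0.
transitivity (phi L); last by apply: (test_fun_out tphi); rewrite in_itv/= ltxx andbF.
rewrite -(Rintegral_derive1_test_fun _ tphi) Rintegral_mkcond [RHS]Rintegral_mkcond.
apply: eq_Rintegral => s _; rewrite !patchE !mem_setE !in_itv/=.
case: (boolP (0 < s < L)) => [/andP[_ /ltW ->]//|sI].
by rewrite (test_fun_out tdphi) ?if_same// in_itv.
Qed.

(** [vprim h] vanishes at L, which identifies the constant of integration as the boundary value. *)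
Lemma weak_deriv_vprim v h : L2 L v -> L2 L h -> is_weak_deriv L v h ->
  eq_L2 L v (fun s => vprim h s + boundary_value L v).
Proof.
move=> lv lh vh.
have H (i : 'I_n) : exists c, {ae mu, forall s, s \in `]0, L[ ->
    v s 0 i = prim L (fun t => h t 0 i) s + c}.
  apply: weak_deriv_primE => //; [exact: L2_intg|exact: L2_intg|].
  by move=> phi tphi; exact: vh.
have [c cP] := choice H.
have vc : eq_L2 L v (fun s => vprim h s + \row_i c i).
  have : {ae mu, forall s, forall i, s \in `]0, L[ ->
      v s 0 i = prim L (fun t => h t 0 i) s + c i} by exact: filter_forall.
  by apply: ae_imply => s e sI; apply/rowP => i; rewrite !mxE e.
suff -> : boundary_value L v = \row_i c i by [].
rewrite (boundary_valueE L0 (within_continuous_vprimD (c := \row_i c i) lh) vc).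
by rewrite vprim_L add0r.
Qed.

Lemma vprim_bound h (eta : R) s i : 0 < eta -> L2 L h ->
  L2_inner L h h <= eta ^+ 2 -> `|vprim h s 0 i| <= (L + 1) * eta.
Proof.
move=> eta0 lh he; rewrite mxE; apply: le_trans (coord_norm_le i L0 eta0 lh he).
by apply: normr_prim_le; exact: L2_intg.
Qed.

(** Each component is at most (L + 1) eta, whence n L (L + 1)^2 eta^2. Enlarging this to a perfect
    square gives it the shape of the hypothesis, so the estimate can be iterated for a double
    integration. *)
Lemma L2_inner_vprim_le h (eta : R) : 0 < eta -> L2 L h ->
  L2_inner L h h <= eta ^+ 2 ->
  L2_inner L (vprim h) (vprim h) <= (n.+1%:R * (L + 1) ^+ 2 * eta) ^+ 2.
Proof.
move=> eta0 lh he; have lp := L2_vprim lh.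
set b := ((L + 1) * eta) ^+ 2.
apply: (@le_trans _ _ (\int[mu]_(s in I) (cst (n%:R * b) s : R))).
  apply: le_Rintegral => //; [exact: intg_dot|exact: integrable_cst_itv|].
  move=> s _ /=; apply: (@le_trans _ _ (\sum_(i < n) b)).
    apply: ler_sum => i _; rewrite -expr2 -[X in X <= _]real_normK ?num_real//.
    rewrite /b lerXn2r ?nnegrE ?mulr_ge0 ?addr_ge0 ?(ltW L0) ?(ltW eta0)//.
    exact: vprim_bound.
  by rewrite sumr_const card_ord mulr_natl.
rewrite Rintegral_cst_itv//.
have -> : (n.+1%:R * (L + 1) ^+ 2 * eta) ^+ 2 = n.+1%:R ^+ 2 * b * (L + 1) ^+ 2.
  by rewrite /b; ring.
have b0 : 0 <= b by exact: sqr_ge0.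
rewrite -(mulrA n%:R) -(mulrA (n.+1%:R ^+ 2)).
apply: ler_pM => //; first by rewrite mulr_ge0// ltW.
  by rewrite -natrX ler_nat expnS expn1 (leq_trans (leqnSn n))// leq_pmulr.
apply: ler_wpM2l => //; have := sqr_ge0 L; have := L0.
by rewrite sqrrD; lra.
Qed.

End WeakDerivative.

(** * The reduced energy *)

Section Curve.
Variables (R : realType) (L : R).
Hypothesis L0 : 0 < L.
Notation mu := (@lebesgue_measure R).
Notation I := [set` `]0, L[%R].
Variable e : 'rV[R]_3.
Implicit Types u v w g d : R -> 'rV[R]_3.

Definition slope g (s : R) : 'rV[R]_3 := vprim L g s - e.
Definition curve g : R -> 'rV[R]_3 := vprim L (slope g).

Lemma eq_L2_sym u v : eq_L2 L u v -> eq_L2 L v u.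
Proof. by apply: ae_imply => s h sI; rewrite h. Qed.

Lemma eq_L2_trans u v w : eq_L2 L u v -> eq_L2 L v w -> eq_L2 L u w.
Proof. by apply: ae_imply2 => s h h' sI; rewrite h// h'. Qed.

Lemma L2_slope g : L2 L g -> L2 L (slope g).
Proof. by move=> lg; exact: (L2_vprimD L0 (- e)). Qed.

Lemma L2_curve g : L2 L g -> L2 L (curve g).
Proof. by move=> lg; apply: L2_vprim => //; exact: L2_slope. Qed.

(** The two boundary conditions fix the two constants of integration, -e for the slope and 0 for the
    curve. *)
Lemma admissible_curve v : admissible L e v ->
  let g := weak_deriv L (weak_deriv L v) in
  [/\ L2 L v, L2 L (weak_deriv L v), L2 L g,
      eq_L2 L (weak_deriv L v) (slope g) & eq_L2 L v (curve g)].
Proof.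
move=> [[/H1P[lv lw wv] /H1P[_ lg ww]] bv bw] g.
have es : eq_L2 L (weak_deriv L v) (slope g).
  by have := weak_deriv_vprim L0 lw lg ww; rewrite bw.
split => //; rewrite /curve -(vprim_ae lw (L2_slope lg) es).
have := weak_deriv_vprim L0 lv lw wv; rewrite bv.
by apply: ae_imply => s h sI; rewrite h// addr0.
Qed.

(** Stated for every representative v, because it is applied to [curve g] itself, to the initial
    segment and to arbitrary feasible functions. *)
Lemma curve_ae_admissible v g : L2 L v -> L2 L g -> eq_L2 L v (curve g) ->
  [/\ admissible L e v, eq_L2 L (weak_deriv L v) (slope g) &
      eq_L2 L (weak_deriv L (weak_deriv L v)) g].
Proof.
move=> lv lg vg.
have ls := L2_slope lg; have lc := L2_curve lg.
have wc : is_weak_deriv L (curve g) (slope g).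
  have := is_weak_deriv_vprimD L0 0 ls.
  by congr is_weak_deriv; apply/funext => s; rewrite addr0.
have wv : is_weak_deriv L v (slope g).
  apply: (is_weak_deriv_ae lc lv ls ls _ _ wc); first exact: eq_L2_sym.
  exact: aeW.
have [lw ww es] := weak_derivP ls wv.
have wg : is_weak_deriv L (weak_deriv L v) g.
  apply: (is_weak_deriv_ae ls lw lg lg _ _ (is_weak_deriv_vprimD L0 (- e) lg)).
    exact: eq_L2_sym.
  exact: aeW.
have [_ _ eg] := weak_derivP lg wg.
split => //; split.
- split; first by split => //; exists (slope g).
  by split => //; exists g.
- by rewrite (boundary_valueE L0 (vprim_continuous L0 ls) vg) vprim_L.
- have cs : {within `[0, L], continuous (slope g)}.
    exact: (within_continuous_vprimD L0 (c := - e) lg).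
  by rewrite (boundary_valueE L0 cs es) /slope vprim_L sub0r.
Qed.

Lemma vprimB g g' s : L2 L g -> L2 L g' ->
  vprim L (fun t => g t - g' t) s = vprim L g s - vprim L g' s.
Proof.
move=> lg lg'; rewrite -scaleN1r -vprimZ// -vprimD//; last exact: L2Z.
by congr (vprim L _ s); apply/funext => t; rewrite scaleN1r.
Qed.

(** The terms -e of the two slopes cancel, so the derivative of v - rc is a primitive of the
    difference of second derivatives with no constant left. *)
Lemma constraint_ae rc v g : admissible L e rc -> L2 L v -> L2 L g ->
  eq_L2 L v (curve g) ->
  eq_L2 L (constraint L rc v) (fun=> 0) <->
  {ae mu, forall s, s \in `]0, L[ ->
    dot (vprim L (fun t => g t - weak_deriv L (weak_deriv L rc) t) s)
        (weak_deriv L rc s) = 0}.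
Proof.
move=> arc lv lg vg.
have [lrc lwr lgr er _] := admissible_curve arc.
have [[[/H1P[_ lw wv] _] _ _] es _] := curve_ae_admissible lv lg vg.
have [[/H1P[_ _ wr] _] _ _] := arc.
(* [weak_deriv] of a difference is a choice of its own and agrees with the difference of the weak
   derivatives only almost everywhere. *)
have [_ _ eD] := weak_derivP (L2B lw lwr) (is_weak_derivB lv lrc lw lwr wv wr).
have E : eq_L2 L (weak_deriv L (fun s => v s - rc s))
    (vprim L (fun t => g t - weak_deriv L (weak_deriv L rc) t)).
  have : eq_L2 L (fun s => weak_deriv L v s - weak_deriv L rc s)
    (vprim L (fun t => g t - weak_deriv L (weak_deriv L rc) t)).
    apply: ae_imply2 es er => s e1 e2 sI; rewrite e1// e2// vprimB//.
    by rewrite /slope opprB addrA subrK.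
  exact: eq_L2_trans.
rewrite /constraint; split.
  by apply: ae_imply2 E => s h /[swap] sI /(_ sI) /eqP;
    rewrite mulf_eq0 pnatr_eq0/= h// => /eqP.
by apply: ae_imply2 E => s h h' sI; rewrite h// h'// mulr0.
Qed.

Lemma prim_cst (c s : R) : s \in `]0, L[ -> prim L (cst c) s = - (c * (L - s)).
Proof.
rewrite in_itv/= => /andP[s0 sL]; rewrite /prim; congr (- _).
transitivity (\int[mu]_(t in `[s, L[) (cst c t : R)).
  rewrite Rintegral_mkcond [RHS]Rintegral_mkcond; apply: eq_Rintegral => t _.
  rewrite !patchE !mem_setE !in_itv/=.
  have [st|ts] := leP s t; last by rewrite mulr0 if_same.
  by rewrite (lt_le_trans s0 st) mulr1.
by rewrite Rintegral_cst//= lebesgue_measure_itv/= lte_fin sL.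
Qed.

(** On (0, L) the straight segment is [curve] of the zero function. *)
Lemma initial_admissible : admissible L e (fun s => (L - s) *: e).
Proof.
have l0 : L2 L (fun=> 0 : 'rV[R]_3).
  apply/L2P => i; have := sqint_cst L 0; congr sqint; apply/funext => s.
  by rewrite mxE.
have s0 : slope (fun=> 0) = fun=> - e.
  apply/funext => s; rewrite /slope -[RHS]sub0r; congr (_ - _).
  rewrite -[RHS](scale0r (vprim L (fun=> 0) s)) -vprimZ//.
  by congr (vprim _ _ _); apply/funext => t; rewrite scale0r.
have [] // := @curve_ae_admissible (fun s => (L - s) *: e) (fun=> 0) _ l0.
  apply: L2_continuous => i; apply: continuous_subspaceT => s.
  have -> : (fun s : R => ((L - s) *: e) 0 i) = (fun s => (L - s) * e 0 i).
    by apply/funext => t; rewrite mxE.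
  apply: cvgMl; apply: cvgB; [exact: cvg_cst|exact: cvg_id].
apply: aeW => s sI; rewrite /curve s0; apply/rowP => i; rewrite !mxE.
rewrite -[prim _ _ _]/(prim L (cst (- e 0 i)) s).
by rewrite prim_cst// mulNr opprK mulrC.
Qed.

End Curve.

(** * The energy as a quadratic functional of the second derivative *)

Section Energy.
Variables (R : realType) (L : R).
Hypothesis L0 : 0 < L.
Implicit Types u v w g d x y : R -> 'rV[R]_3.
Notation N u := (L2_inner L u u).

Lemma L2_innerDD u v t : L2 L u -> L2 L v ->
  N (fun s => u s + t *: v s) = N u + t * (2 * L2_inner L u v) + t ^+ 2 * N v.
Proof.
move=> lu lv; have ltv := L2Z t lv; have lD := L2D lu ltv.
rewrite L2_innerDl// !L2_innerDr// !L2_innerZl// !L2_innerZr// (L2_innerC L v u).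
by ring.
Qed.

(** Nonnegativity of |u + t v|^2 at t = 1/eta and t = -1/eta, multiplied by eta. *)
Lemma L2_inner_young u v (eta : R) : 0 < eta -> L2 L u -> L2 L v ->
  `|2 * L2_inner L u v| <= eta * N u + N v / eta.
Proof.
move=> eta0 lu lv.
have h t : 0 <= N u + t * (2 * L2_inner L u v) + t ^+ 2 * N v.
  by rewrite -L2_innerDD//; exact: L2_inner_ge0.
have h1 := h eta^-1; have h2 := h (- eta^-1).
have E : eta * N u + N v / eta = eta * (N u + eta^-1 ^+ 2 * N v).
  by field; rewrite gt_eqF.
have E1 : 2 * L2_inner L u v = eta * (eta^-1 * (2 * L2_inner L u v)).
  by field; rewrite gt_eqF.
rewrite E ler_norml E1 -mulrN !ler_pM2l//.
by apply/andP; split; move: h1 h2; rewrite sqrrN; lra.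
Qed.

Variables (e : 'rV[R]_3) (b c : R) (F p : R -> 'rV[R]_3).
Hypotheses (b0 : 0 < b) (c0 : 0 < c) (lF : L2 L F) (lp : L2 L p).
Notation curve := (curve L e).

(** To be used with c = omega / tau^2 and p = 2 r_k - r_(k-1), see [energy_curve]. *)
Definition reduced_energy g : R :=
  c * N (fun s => curve g s - p s) + b * N g - 2 * L2_inner L F (curve g).

(** The linear part of the affine map [curve]. *)
Definition response d : R -> 'rV[R]_3 := vprim L (vprim L d).

Lemma curveD g d t : L2 L g -> L2 L d ->
  curve (fun s => g s + t *: d s) = fun s => curve g s + t *: response d s.
Proof.
move=> lg ld; apply/funext => s; have lt := L2Z t ld; have lP := L2_vprim L0 ld.
rewrite /curve /response -vprimZ// -vprimD//; [|exact: L2_slope|exact: L2Z].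
congr (vprim _ _ s); apply/funext => x.
by rewrite /slope vprimD// vprimZ// addrAC.
Qed.

Definition energy_slope g d : R :=
  c * (2 * L2_inner L (fun s => curve g s - p s) (response d)) +
  b * (2 * L2_inner L g d) - 2 * L2_inner L F (response d).

Definition energy_curvature d : R := c * N (response d) + b * N d.

(** The expansion is exact because [curve] is affine. Both the gap estimate and the passage to the
    limit are read off its coefficients. *)
Lemma reduced_energy_line g d t : L2 L g -> L2 L d ->
  reduced_energy (fun s => g s + t *: d s) =
  reduced_energy g + t * energy_slope g d + t ^+ 2 * energy_curvature d.
Proof.
move=> lg ld.
have lr : L2 L (response d) by apply: L2_vprim => //; exact: L2_vprim.
have lc := L2_curve L0 e lg.
have lcp := L2B lc lp.
have ltr := L2Z t lr.
rewrite /reduced_energy curveD//.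
have -> : (fun s => curve g s + t *: response d s - p s) =
    (fun s => curve g s - p s + t *: response d s).
  by apply/funext => s; rewrite addrAC.
rewrite !L2_innerDD// (L2_innerDr lc ltr lF).
rewrite L2_innerZr// /energy_slope /energy_curvature.
set X := fun s => curve g s - p s.
move: (L2_inner L X X) (L2_inner L X (response d)) (L2_inner L g g)
  (L2_inner L (response d) (response d)) (L2_inner L g d) (L2_inner L d d)
  (L2_inner L F (curve g)) (L2_inner L F (response d)) => {X} *.
by ring.
Qed.

(** Young's inequality with weight 1/c, for F and [curve g - p], lets the inertial term absorb the
    force term; what remains depends on F, p and c only. *)
Lemma reduced_energy_bounded : exists m, forall g, L2 L g -> m <= reduced_energy g.
Proof.
exists (- (c^-1 * N F) - 2 * L2_inner L F p) => g lg.
have lc := L2_curve L0 e lg; have lcp := L2B lc lp.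
have c'0 : 0 < c^-1 by rewrite invr_gt0.
have := L2_inner_young c'0 lF lcp; rewrite invrK => /(le_trans (ler_norm _)).
have -> : L2_inner L F (fun s => curve g s - p s) =
    L2_inner L F (curve g) - L2_inner L F p.
  have -> : (fun s => curve g s - p s) = (fun s => curve g s + (-1) *: p s).
    by apply/funext => s; rewrite scaleN1r.
  by rewrite L2_innerDr// ?L2_innerZr// ?mulN1r//; exact: L2Z.
have := mulr_ge0 (ltW b0) (L2_inner_ge0 L g).
by rewrite /reduced_energy; lra.
Qed.

(** C depends on g but not on d: this compares the energy of a limit g with that of its
    approximations. *)
Lemma energy_slope_bound g : L2 L g -> exists2 C, 0 <= C &
  forall d (eta : R), 0 < eta -> L2 L d -> N d <= eta ^+ 2 ->
    `|energy_slope g d| <= C * eta.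
Proof.
move=> lg; have lcp := L2B (L2_curve L0 e lg) lp.
(* By [L2_inner_vprim_le] in dimension three, k bounds one integration and k * k two; D is the
   square of the latter. Young's inequality with weight eta makes each of the three terms of the
   slope linear in eta. *)
set k : R := 4%:R * (L + 1) ^+ 2.
have k0 : 0 < k by rewrite mulr_gt0// exprn_gt0// addr_gt0.
set X := fun s => curve g s - p s.
pose D := (k * k) ^+ 2.
have D0 : 0 <= D by exact: sqr_ge0.
exists (c * (N X + D) + b * (N g + 1) + (N F + D)).
  by rewrite !addr_ge0// ?mulr_ge0// ?addr_ge0// ?L2_inner_ge0// ltW.
move=> d eta eta0 ld de.
have lr1 := L2_vprim L0 ld.
have lr : L2 L (response d) by exact: L2_vprim.
have r1 := L2_inner_vprim_le L0 eta0 ld de.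
have r2 := L2_inner_vprim_le L0 (mulr_gt0 k0 eta0) lr1 r1.
have rE : N (response d) / eta <= D * eta.
  rewrite ler_pdivrMr//; apply: le_trans r2 _.
  by rewrite -/k le_eqVlt; apply/orP; left; apply/eqP; rewrite /D; ring.
have dE : N d / eta <= eta by rewrite ler_pdivrMr// -expr2.
have y1 := L2_inner_young eta0 lcp lr; have y2 := L2_inner_young eta0 lg ld; have y3 := L2_inner_young eta0 lF lr.
rewrite -/X in y1.
apply: (le_trans (ler_normB _ _)).
apply: (le_trans (lerD (ler_normD _ _) (lexx _))).
rewrite !(normrM c) !(normrM b) !(gtr0_norm c0) !(gtr0_norm b0).
move: y1 y2 y3 rE dE; clear D0.
move: (`|2 * L2_inner L X (response d)|) (`|2 * L2_inner L g d|)
  (`|2 * L2_inner L F (response d)|) (N X) (N g) (N F)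
  (N (response d) / eta) (N d / eta) (D) => y1 y2 y3 nX ng nF nr nd D' h1 h2 h3 h4 h5.
have z1 : c * y1 <= c * (eta * nX + D' * eta) by rewrite ler_pM2l//; lra.
have z2 : b * y2 <= b * (eta * ng + eta) by rewrite ler_pM2l//; lra.
lra.
Qed.

End Energy.

(** * Minimization *)

Lemma le_geometric_limit (R : realType) (x y C : R) : 0 <= C ->
  (forall n : nat, x <= y + C * 2^-1 ^+ n) -> x <= y.
Proof.
move=> C0 h; rewrite leNgt; apply/negP => yx.
have : C * 2^-1 ^+ n @[n --> \oo] --> C * 0.
  by apply: cvgMr; apply: cvg_expr; rewrite ger0_norm ?invr_ge0// invf_lt1// ltr1n.
rewrite mulr0 => /cvgrPdist_lt /(_ (x - y)); rewrite subr_gt0 => /(_ yx)[n _ /(_ n (leqnn _))].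
rewrite /= sub0r normrN ger0_norm ?mulr_ge0 ?exprn_ge0 ?invr_ge0//.
by have := h n; lra.
Qed.

Section Minimization.
Variables (R : realType) (L : R).
Hypothesis L0 : 0 < L.
Notation mu := (@lebesgue_measure R).
Notation N u := (L2_inner L u u).
Variables (e : 'rV[R]_3) (b c : R) (F p : R -> 'rV[R]_3).
Hypotheses (b0 : 0 < b) (c0 : 0 < c) (lF : L2 L F) (lp : L2 L p).
Variables (g0 rho : R -> 'rV[R]_3).
Hypothesis lg0 : L2 L g0.
Notation E := (reduced_energy L e b c F p).

(** [g0] and [rho] stand for the second and the first derivative of the current iterate. *)
Definition linearized : set (R -> 'rV[R]_3) := [set g | L2 L g /\
  {ae mu, forall s, s \in `]0, L[ ->
    dot (vprim L (fun t => g t - g0 t) s) (rho s) = 0}].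

Lemma linearized_line g g' t : linearized g -> linearized g' ->
  linearized (fun s => g s + t *: (g' s - g s)).
Proof.
move=> [lg kg] [lg' kg']; have lB := L2B lg' lg.
split; first by apply: L2D => //; exact: L2Z.
apply: ae_imply2 kg kg' => s h h' sI; move: (h sI) (h' sI).
rewrite !vprimB//; last by apply: L2D => //; exact: L2Z.
rewrite vprimD//; last exact: L2Z.
rewrite vprimZ// vprimB// => h1 h2.
have -> : vprim L g s + t *: (vprim L g' s - vprim L g s) - vprim L g0 s =
    (1 - t) *: (vprim L g s - vprim L g0 s) + t *: (vprim L g' s - vprim L g0 s).
  by apply/rowP => i; rewrite !mxE; ring.
by rewrite dotDl !dotZl h1 h2 !mulr0 addr0.
Qed.

(** At the midpoint the energy is the mean of the end values minus a quarter of the curvature, and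
    it is at least m. With m the infimum this gives both the Cauchy property and uniqueness. *)
Lemma linearized_gap g g' m : linearized g -> linearized g' ->
  (forall h, linearized h -> m <= E h) ->
  b * N (fun s => g' s - g s) <= 2 * (E g - m) + 2 * (E g' - m).
Proof.
move=> kg kg' hm; have [[lg _] [lg' _]] := (kg, kg').
have lB := L2B lg' lg.
have /hm := linearized_line 2^-1 kg kg'.
have line t := reduced_energy_line L0 e b c lF lp t lg lB.
have : E g' = E (fun s => g s + 1 *: (g' s - g s)).
  by congr reduced_energy; apply/funext => s; rewrite scale1r addrC subrK.
have := mulr_ge0 (ltW c0) (L2_inner_ge0 L (response L (fun s => g' s - g s))).
rewrite !line /energy_curvature.
move: (E g) (E g') (energy_slope _ _ _ _ _ _ _ _) (c * _) (b * _) => *.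
lra.
Qed.

Lemma linearized_closed (g_ : nat -> R -> 'rV[R]_3) g :
  (forall n, linearized (g_ n)) -> L2 L g ->
  (forall n, N (fun s => g s - g_ n s) <= (4%:R * 2^-1 ^+ n) ^+ 2) ->
  linearized g.
Proof.
move=> kg lg gn; split=> //.
(* A single null set has to serve all n before s is fixed. *)
have : {ae mu, forall s, forall n, s \in `]0, L[ ->
    dot (vprim L (fun t => g_ n t - g0 t) s) (rho s) = 0}.
  by apply: ae_foralln => n; exact: (kg n).2.
apply: ae_imply => s h sI.
have lgn n : L2 L (g_ n) := (kg n).1.
(* C depends on s through [rho s], which is harmless because the limit in n is taken at fixed s. *)
set C := \sum_(i < 3) (L + 1) * 4%:R * `|rho s 0 i|.
have C0 : 0 <= C.
  by apply: sumr_ge0 => i _; rewrite !mulr_ge0// addr_ge0// ltW.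
suff : `|dot (vprim L (fun t => g t - g0 t) s) (rho s)| <= 0.
  by rewrite normr_le0 => /eqP.
apply: (le_geometric_limit C0) => n; rewrite add0r.
have -> : vprim L (fun t => g t - g0 t) s =
    vprim L (fun t => g_ n t - g0 t) s + vprim L (fun t => g t - g_ n t) s.
  by rewrite !vprimB//; apply/rowP => i; rewrite !mxE; ring.
rewrite dotDl (h n sI) add0r /dot (le_trans (ler_norm_sum _ _ _))//.
rewrite /C mulr_suml; apply: ler_sum => i _.
rewrite normrM mulrAC ler_wpM2r// -mulrA.
by apply: vprim_bound => //; exact: L2B.
Qed.

Lemma linearized_minimizer : linearized g0 ->
  exists2 g, linearized g & forall h, linearized h -> E g <= E h.
Proof.
move=> k0; have [lb lbP] := reduced_energy_bounded L0 e b0 c0 lF lp.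
pose S : set R := E @` linearized.
have hS : has_inf S.
  split; first by exists (E g0), g0.
  by exists lb => _ [g [lg _] <-]; exact: lbP.
pose m := inf S.
have mP h : linearized h -> m <= E h.
  by move=> kh; apply: ge_inf; [exact: hS.2|exists h].
(* The excess b/4 * 4^-n is chosen so that [linearized_gap], with its two factors 2, yields exactly
   the Cauchy rate of [L2_complete]. *)
have seq n : exists g, linearized g /\ E g <= m + b / 4%:R * (2^-1 ^+ n) ^+ 2.
  have eps : 0 < b / 4%:R * (2^-1 ^+ n) ^+ 2 by rewrite mulr_gt0 ?divr_gt0// !exprn_gt0// invr_gt0.
  have [_ [g kg <-] /ltW gE] := inf_adherent eps hS.
  by exists g.
have [g_ gP] := choice seq.
have kg n : linearized (g_ n) := (gP n).1.
have lgn n : L2 L (g_ n) := (kg n).1.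
have [|g lg gn] := L2_complete L0 lgn.
  move=> k n kn; rewrite -(ler_pM2l b0).
  apply: le_trans (linearized_gap (kg k) (kg n) mP) _.
  have := (gP k).2; have := (gP n).2.
  have : (2^-1 ^+ n) ^+ 2 <= (2^-1 ^+ k) ^+ 2 :> R.
    rewrite lerXn2r ?nnegrE ?exprn_ge0 ?invr_ge0//.
    by apply: ler_wiXn2l => //; rewrite ?invr_ge0// invf_le1// ler1n.
  move=> /(ler_wpM2l (ltW b0)).
  move: (E (g_ n)) (E (g_ k)) ((2^-1 ^+ n) ^+ 2) ((2^-1 ^+ k) ^+ 2) => *; lra.
have kG := linearized_closed kg lg gn.
exists g; first exact: kG.
move=> h kh; apply: (@le_trans _ _ m _ _ _ (mP h kh)).
have [C C0 CP] := energy_slope_bound L0 e b0 c0 lF lp lg.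
(* Expand E (g_ n) around the limit g: the curvature is nonnegative, the slope costs at most C * 4 *
   2^-n, and E (g_ n) exceeds m by at most b * 2^-n. *)
apply: (@le_geometric_limit _ _ _ (C * 4%:R + b)); first by rewrite addr_ge0 ?mulr_ge0// ltW.
move=> n; have := (gP n).2.
have lB := L2B (lgn n) lg.
have -> : g_ n = (fun s => g s + 1 *: (g_ n s - g s)).
  by apply/funext => s; rewrite scale1r addrC subrK.
rewrite (reduced_energy_line L0 e b c lF lp 1 lg lB) expr1n !mul1r.
have eta0 : 0 < 4%:R * 2^-1 ^+ n :> R by rewrite mulr_gt0// exprn_gt0// invr_gt0.
have hN : N (fun s => g_ n s - g s) <= (4%:R * 2^-1 ^+ n) ^+ 2.
  apply: le_trans (gn n); rewrite le_eqVlt; apply/orP; left; apply/eqP.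
  apply: eq_Rintegral => s _; rewrite -opprB -scaleN1r dotZl dotC dotZl.
  by rewrite !mulN1r opprK.
have := CP _ _ eta0 lB hN; rewrite ler_norml => /andP[h1 _].
have h2 : 0 <= energy_curvature L b c (fun s => g_ n s - g s).
  by rewrite addr_ge0// mulr_ge0 ?L2_inner_ge0// ltW.
have x0 : 0 <= 2^-1 ^+ n :> R by rewrite exprn_ge0// invr_ge0.
have x1 : 2^-1 ^+ n <= 1 :> R by apply: exprn_ile1; rewrite ?invr_ge0// invf_le1// ler1n.
have : b / 4%:R * (2^-1 ^+ n) ^+ 2 <= b * 2^-1 ^+ n.
  have := ler_wpM2l x0 x1; rewrite mulr1 -expr2 => h3.
  have := ler_wpM2l (ltW b0) h3; have := mulr_ge0 (ltW b0) (sqr_ge0 (2^-1 ^+ n : R)); lra.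
move: h1 h2; move: (E g) (energy_slope _ _ _ _ _ _ _ _) (energy_curvature _ _ _ _)
  (b / 4%:R * (2^-1 ^+ n) ^+ 2) (2^-1 ^+ n) => *; lra.
Qed.

(** The gap estimate with m the common minimal value leaves no room for a positive distance. *)
Lemma linearized_minimizer_unique g g' : linearized g -> linearized g' ->
  (forall h, linearized h -> E g <= E h) ->
  (forall h, linearized h -> E g' <= E h) -> eq_L2 L g g'.
Proof.
move=> kg kg' mg mg'; have [[lg _] [lg' _]] := (kg, kg').
have EE : E g' = E g by apply: le_anti; apply/andP; split; [exact: (mg' g kg)|exact: (mg g' kg')].
have := linearized_gap kg' kg mg; rewrite EE !subrr mulr0 addr0.
rewrite (pmulr_rle0 _ b0) => /(L2_inner_eq0 (L2B lg lg')).
by apply: ae_imply => s h sI; apply/eqP; rewrite -subr_eq0 h.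
Qed.

End Minimization.

(** The scaled second difference is (tau / tau^2) (v - p) with p = 2 rc - rp, which explains the
    weight and the shift. *)
Lemma energy_curve (R : realType) (L omega b tau : R) (e : 'rV[R]_3)
    (F rc rp v g : R -> 'rV[R]_3) : 0 < L ->
  L2 L F -> L2 L rc -> L2 L rp -> L2 L v -> L2 L g -> eq_L2 L v (curve L e g) ->
  energy L omega b tau F rc rp v =
  reduced_energy L e b (omega * (tau * (tau ^+ 2)^-1) ^+ 2) F
    (fun s => 2 *: rc s - rp s) g.
Proof.
move=> L0 lF lrc lrp lv lg vg.
have lc := L2_curve L0 e lg.
have lp : L2 L (fun s => 2 *: rc s - rp s) by apply: L2B => //; exact: L2Z.
have [[[_ H1w] _ _] _ eg] := curve_ae_admissible L0 lv lg vg.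
have [_ lww _] := H1P H1w.
rewrite /energy /reduced_energy /L2_norm !sqr_sqrtr ?L2_inner_ge0//.
congr (_ + _ - 2 * _).
- rewrite -mulrA; congr (_ * _).
  have lB := L2B lv lp.
  have -> : (fun s => tau *: second_diff tau rc rp v s) =
      (fun s => (tau * (tau ^+ 2)^-1) *: (v s - (2 *: rc s - rp s))).
    by apply/funext => s; rewrite /second_diff scalerA opprB addrCA addrC.
  have lZ := L2Z (tau * (tau ^+ 2)^-1) lB.
  rewrite L2_innerZl// L2_innerZr// mulrA -expr2; congr (_ * _).
  have vB : eq_L2 L (fun s => v s - (2 *: rc s - rp s))
      (fun s => curve L e g s - (2 *: rc s - rp s)).
    by apply: ae_imply vg => s h sI; rewrite h.
  have lcB := L2B lc lp.
  exact: L2_inner_ae.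
- by congr (_ * _); apply: L2_inner_ae.
- by apply: L2_inner_ae => //; exact: aeW.
Qed.

(** * Levels of the scheme *)

Section Run.
Variables (R : realType) (L T omega b tau : R) (e_g : 'rV[R]_3).
Variables (f : R * R -> 'rV[R]_3) (r : nat -> R -> 'rV[R]_3) (k : nat).
Hypothesis L0 : 0 < L.

Lemma run_admissible (j : nat) : is_run L omega b tau e_g f r k -> (j <= k)%N ->
  admissible L e_g (r j).
Proof.
move=> [r0 r1 rj] jk; case: j jk => [_|[_|j jk]].
- by rewrite r0; exact: initial_admissible.
- by rewrite r1; exact: initial_admissible.
- by have [[]] := rj j.+1 jk.
Qed.

Lemma L2_slice (t : R) : {within `[0, L] `*` `[0, T], continuous f} ->
  t \in `[0, T] -> L2 L (fun s => f (s, t)).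
Proof.
move=> fc tT; apply: L2_continuous => i; apply: within_continuous_coord.
apply/subspace_continuousP => s sL U.
have /subspace_continuousP /(_ (s, t) (conj sL tT)) fc' := fc.
move=> /fc' H.
have ct : (s', t) @[s' --> s] --> (s, t).
  exact: (cvg_pair (F := nbhs s) (G := nbhs s) (H := nbhs t) cvg_id (cvg_cst t)).
rewrite -[_ U]/(nbhs s [set s' | `[0, L]%classic s' -> U (f (s', t))]).
have h : nbhs s [set s' | (`[0, L] `*` `[0, T])%classic (s', t) -> U (f (s', t))].
  exact: (ct _ H).
apply: (@filterS _ (nbhs s) _ _ _ _ h) => s' {}h sL'.
exact: (h (conj sL' tT)).
Qed.

End Run.

Theorem theorem3 (R : realType) (L T omega b : R)
    (L_gt0 : 0 < L) (T_gt0 : 0 < T) (omega_gt0 : 0 < omega) (b_gt0 : 0 < b)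
    (e_g : 'rV[R]_3) (e_g_unit : enorm e_g = 1)
    (f : R * R -> 'rV[R]_3)
    (f_cont : {within `[0, L] `*` `[0, T], continuous f})
    (N : nat) (N_gt0 : (0 < N)%N) (tau : R) (tauE : tau = T / N%:R)
    (k : nat) (k_level : (1 <= k <= N - 1)%N)
    (r : nat -> R -> 'rV[R]_3) (r_run : is_run L omega b tau e_g f r k) :
  exists v : R -> 'rV[R]_3,
    solves_level L omega b tau e_g f r k v /\
    forall w : R -> 'rV[R]_3,
      solves_level L omega b tau e_g f r k w -> eq_L2 L w v.
Proof.
have tau0 : 0 < tau by rewrite tauE divr_gt0// ltr0n.
have /andP[k1 kN] := k_level.
pose F s := f (s, k.+1%:R * tau).
have lF : L2 L F.
  (* As N > 0, the bound k <= N - 1 keeps the time t_(k+1) inside [0, T], where f is continuous. *)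
  have kN1 : (k.+1 <= N)%N by rewrite -(subnK N_gt0) addn1 ltnS.
  apply: L2_slice f_cont _; rewrite in_itv/= mulr_ge0 ?(ltW tau0)//= tauE mulrCA.
  rewrite ler_piMr ?(ltW T_gt0)// ler_pdivrMr ?ltr0n// mul1r ler_nat.
  exact: kN1.
have arc := run_admissible L_gt0 r_run (leqnn k).
have [lrc _ lg0 _ _] := admissible_curve L_gt0 arc.
have [lrp _ _ _ _] := admissible_curve L_gt0 (run_admissible L_gt0 r_run (leq_pred k)).
set g0 := weak_deriv L (weak_deriv L (r k)) in lg0.
pose rho := weak_deriv L (r k).
pose c := omega * (tau * (tau ^+ 2)^-1) ^+ 2.
have c0 : 0 < c by rewrite mulr_gt0// exprn_gt0// mulr_gt0// invr_gt0 exprn_gt0.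
pose p s := 2 *: r k s - r k.-1 s.
have lp : L2 L p by apply: L2B => //; exact: L2Z.
pose J := energy L omega b tau F (r k) (r k.-1).
pose E := reduced_energy L e_g b c F p.
(* Together with [feasible_curve] this transfers minimality both ways between curves and second
   derivatives. *)
have feasibleE w : feasible L e_g (r k) w ->
    let g := weak_deriv L (weak_deriv L w) in
    [/\ linearized L g0 rho g, J w = E g & eq_L2 L w (curve L e_g g)].
  move=> [aw cw] g; have [lw _ lg _ wg] := admissible_curve L_gt0 aw.
  split; [|exact: energy_curve|exact: wg].
  split; first exact: lg.
  exact: (iffLR (constraint_ae L_gt0 arc lw lg wg)).
have feasible_curve g : linearized L g0 rho g ->
    feasible L e_g (r k) (curve L e_g g) /\ J (curve L e_g g) = E g.
  move=> [lg kg]; have lc := L2_curve L_gt0 e_g lg.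
  have cc : eq_L2 L (curve L e_g g) (curve L e_g g) by exact: aeW.
  split; last exact: energy_curve.
  split; first by have [] := curve_ae_admissible L_gt0 lc lg cc.
  exact: (iffRL (constraint_ae L_gt0 arc lc lg cc)).
(* The current iterate is feasible: its constraint involves the primitive of g0 - g0. *)
have k0 : linearized L g0 rho g0.
  split; first exact: lg0.
  apply: aeW => s _; rewrite vprimB// subrr.
  by rewrite -(scale0r (0 : 'rV[R]_3)) dotZl mul0r.
have [g kg gmin] := linearized_minimizer L_gt0 e_g b_gt0 c0 lF lp lg0 k0.
have [fg Jg] := feasible_curve g kg.
exists (curve L e_g g); split.
  split; first exact: fg.
  move=> w /feasibleE[kw Jw _].
  by rewrite -/(J w) -/(J (curve L e_g g)) Jg Jw; exact: gmin.
move=> w [fw wmin]; have [kw Jw wc] := feasibleE w fw.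
have hw h : linearized L g0 rho h -> E (weak_deriv L (weak_deriv L w)) <= E h.
  by move=> /feasible_curve[fh <-]; rewrite -Jw; exact: wmin.
have gw := linearized_minimizer_unique L_gt0 b_gt0 c0 lF lp lg0 kw kg hw gmin.
have [[lw _] [lg _]] := (kw, kg).
(* [curve] sees its argument only up to null sets, so both second derivatives integrate to the same
   curve. *)
rewrite /curve (vprim_ae (L2_slope L_gt0 e_g lw) (L2_slope L_gt0 e_g lg)) in wc.
  exact: wc.
by apply: aeW => s _; rewrite /slope (vprim_ae lw lg gw).
Qed.
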